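(* For every positive integer $d$ there is $\mu_0=\mu_0(d)>0$ such that for every $\mu$ with $0<\mu\le\mu_0$ there exists $n_0=n_0(d,\mu)$ with the following property. For every odd $n>n_0$, every subdivision tree $T$ on $n$ vertices in which every vertex has degree at most $d$, and every Steiner triple system $S$ on $m\ge(1+\mu)n$ vertices, $T$ is a subhypergraph of $S$ (i.e. there is an injective map $V(T)\to V(S)$ sending every edge of $T$ to an edge of $S$).
   Context: A hypertree is a connected, simple $3$-uniform hypergraph in which every two vertices are joined by a unique path. A subdivision tree is a hypertree in which each edge contains a vertex of degree one; equivalently it is obtained from a graph tree $T'$ by replacing each edge $\{x,y\}$ of $T'$ by a $3$-edge $\{x,y,z_{xy}\}$ with a new vertex $z_{xy}$. A Steiner triple system is a $3$-uniform hypergraph in which every pair of vertices is contained in exactly one edge. The paper states the hypothesis on $\mu$ as ''$\frac1d\gg\mu$'', meaning $\mu$ is sufficiently small in terms of $d$. *)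

(* Defs.v *)
From mathcomp Require Import all_boot all_order all_algebra.
From mathcomp Require Import reals.

Set Implicit Arguments.
Unset Strict Implicit.
Unset Printing Implicit Defensive.

(* A simple hypergraph with vertex set the whole finite type [V] is given by
   its set of edges [E : {set {set V}}]. *)
Section Hypergraph.
Variables (V : finType) (E : {set {set V}}).

Definition uniform3 : Prop := forall e, e \in E -> #|e| = 3.

Definition hdegree (v : V) : nat := #|[set e in E | v \in e]|.

Definition hadjacent : rel V :=
  fun x y => [exists e in E, (x \in e) && (y \in e)].

Definition hconnected : Prop := forall x y : V, connect hadjacent x y.

(* The walk x, e_1, v_1, ..., e_k, v_k is encoded by its start [x] and the
   sequence [p] of the pairs (e_i, v_i). *)
Fixpoint hwalk (x : V) (p : seq ({set V} * V)) : bool :=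
  if p is (e, v) :: p' then
    [&& e \in E, x \in e, v \in e & hwalk v p']
  else true.

(* A path repeats neither vertices nor edges. *)
Definition hpath (x y : V) (p : seq ({set V} * V)) : Prop :=
  [/\ hwalk x p, last x (unzip2 p) = y,
      uniq (x :: unzip2 p) & uniq (unzip1 p)].

Definition hypertree : Prop :=
  [/\ uniform3, hconnected & forall x y : V, exists! p, hpath x y p].

Definition subdivision_tree : Prop :=
  hypertree /\
  forall e, e \in E -> exists2 v, v \in e & hdegree v = 1.

Definition steiner_triple_system : Prop :=
  uniform3 /\
  forall x y : V, x != y -> exists! e, [/\ e \in E, x \in e & y \in e].

End Hypergraph.

Definition subhypergraph (V W : finType)
    (E : {set {set V}}) (F : {set {set W}}) : Prop :=
  exists2 f : V -> W, injective f & forall e, e \in E -> f @: e \in F.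

(* Main.v *)
(** A Steiner triple system is an idempotent commutative quasigroup [op] with
    [op x (op x y) = y], and a subdivision tree is a rooted tree whose edge from
    [top e] to [bot e] carries a private vertex [mid e].  Cut the tree at the
    vertices whose depth lies in the sparsest residue class modulo a large
    constant [L]; the other edges fall into boundedly many classes, given by
    the level modulo [L] and the index of the child, so that the edges of a
    class have distinct tops.  Label the points of the system independently at
    random: class [i] receives two sets [Y_i], [Z_i], each slightly larger than
    the class, and the rest is a reserve [Q] of linear size.

    By a fourth moment computation, for every label class [C] the number of
    pairs [(a, b)] in [A * B] with [op a b] in [C] is close to its expected
    value, uniformly in [A] and [B].  Hence, as long as linearly many edges of
    class [i] whose tops are already embedded at the points [P] are unassigned,
    every [A] included in [Y_i] has almost [#|A|] points [z] of [Z_i] in which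
    many [y] in [A] satisfy [op y z \in P].  As [Y_i] and [Z_i] have a linear
    surplus, this produces a bounded augmenting path, so level by level almost
    all edges are embedded.  The few remaining vertices are embedded greedily
    into [Q]: for any [d] points [u], a positive proportion of the [q] in [Q]
    have all [op q u] in [Q]. *)

Require Import Defs.
From mathcomp Require Import all_boot all_order all_algebra.
From mathcomp Require Import reals.
From mathcomp Require Import ring lra zify.
Set Implicit Arguments.
Unset Strict Implicit.
Unset Printing Implicit Defensive.
Import Order.TTheory GRing.Theory Num.Theory.
Local Open Scope ring_scope.

(** * Expectation over random labellings *)

Section ProductExpectation.
Variables (R : realFieldType) (W I : finType) (w : I -> R).
Hypothesis w_ge0 : forall i, 0 <= w i.
Hypothesis w_sum1 : \sum_i w i = 1.

Definition expectation (g : {ffun W -> I} -> R) : R :=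
  \sum_(f : {ffun W -> I}) (\prod_x w (f x)) * g f.

Lemma expectation_prod (F : W -> I -> R) :
  expectation (fun f => \prod_x F x (f x)) = \prod_x \sum_i w i * F x i.
Proof.
rewrite /expectation bigA_distr_bigA; apply: eq_bigr => f _.
by rewrite big_split.
Qed.

Lemma expectation_cst c : expectation (fun=> c) = c.
Proof.
rewrite /expectation -big_distrl /= -(bigA_distr_bigA (fun _ => w)) /=.
by rewrite big1 ?mul1r // => x _; rewrite w_sum1.
Qed.

Lemma weight_ge0 (f : {ffun W -> I}) : 0 <= \prod_x w (f x).
Proof. by apply: prodr_ge0 => x _. Qed.

Lemma eq_expectation g h : g =1 h -> expectation g = expectation h.
Proof. by move=> gh; apply: eq_bigr => f _; rewrite gh. Qed.

Lemma ler_expectation g h :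
  (forall f, g f <= h f) -> expectation g <= expectation h.
Proof. by move=> gh; apply: ler_sum => f _; rewrite ler_wpM2l ?weight_ge0. Qed.

Lemma expectationD g h :
  expectation (fun f => g f + h f) = expectation g + expectation h.
Proof.
by rewrite /expectation -big_split; apply: eq_bigr => f _; rewrite mulrDr.
Qed.

Lemma expectationZ c g : expectation (fun f => c * g f) = c * expectation g.
Proof.
by rewrite /expectation big_distrr; apply: eq_bigr => f _ /=; rewrite mulrCA.
Qed.

Lemma expectation_sum (J : finType) (g : J -> {ffun W -> I} -> R) :
  expectation (fun f => \sum_j g j f) = \sum_j expectation (g j).
Proof.
by rewrite /expectation exchange_big; apply: eq_bigr => f _ /=;
   rewrite big_distrr.
Qed.

Lemma expectation_lt_ex g c :
  expectation g < c -> exists f, g f < c.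
Proof.
move=> gc; case: (pickP (fun f => g f < c)) => [f fP|nP]; first by exists f.
have : c <= expectation g.
  rewrite -[leLHS](expectation_cst c); apply: ler_expectation => f.
  by rewrite leNgt nP.
by rewrite leNgt gc.
Qed.

(* Swapping the coordinates outside [A] of a pair of independent samples is a
   measure preserving involution. *)
Lemma expectation_indep (A : {pred W}) (g h : {ffun W -> I} -> R) :
  (forall f f' : {ffun W -> I}, (forall x, x \in A -> f x = f' x) -> g f = g f') ->
  (forall f f' : {ffun W -> I}, (forall x, x \notin A -> f x = f' x) -> h f = h f') ->
  expectation (fun f => g f * h f) = expectation g * expectation h.
Proof.
move=> gA hA.
(* The factor 1 is the expectation of 1 over a second independent sample, so both sides become sums
   over pairs of labellings. *)
rewrite -[LHS]mulr1 -[in LHS](expectation_cst 1) /expectation.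
rewrite !big_distrlr /= !pair_big /=.
pose s (q : {ffun W -> I} * {ffun W -> I}) :=
  ([ffun x => if x \in A then q.1 x else q.2 x],
   [ffun x => if x \in A then q.2 x else q.1 x]).
have sK : involutive s.
  move=> [f f']; rewrite /s /=; congr pair; apply/ffunP => x; rewrite !ffunE;
  by case: (x \in A).
rewrite [RHS](reindex_inj (inv_inj sK)) /=; apply: eq_bigr => -[f f'] _ /=.
rewrite (gA [ffun x => if x \in A then f x else f' x] f); last first.
  by move=> x xA; rewrite ffunE xA.
rewrite (hA [ffun x => if x \in A then f' x else f x] f); last first.
  by move=> x /negbTE xA; rewrite ffunE xA.
rewrite [RHS]mulrACA -[in RHS]big_split /=.
suff -> : \prod_x (w ([ffun x => if x \in A then f x else f' x] x) *
  w ([ffun x => if x \in A then f' x else f x] x)) =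
  (\prod_x w (f x)) * \prod_x w (f' x) by ring.
rewrite -big_split /=.
by apply: eq_bigr => x _; rewrite !ffunE; case: ifP => // _; rewrite mulrC.
Qed.

Lemma expectation_coord x (phi : I -> R) :
  expectation (fun f => phi (f x)) = \sum_i w i * phi i.
Proof.
rewrite (@eq_expectation _ (fun f => \prod_y (if y == x then phi (f y) else 1))).
  rewrite (expectation_prod (fun y i => if y == x then phi i else 1)).
  rewrite (bigD1 x) //= eqxx [X in _ * X]big1 ?mulr1 // => y /negbTE ->.
  by rewrite -[RHS]w_sum1; apply: eq_bigr => i _; rewrite mulr1.
by move=> f; rewrite -big_mkcond big_pred1_eq.
Qed.

Lemma expectation_block (A : {set W}) i0 :
  expectation (fun f => [forall x in A, f x == i0]%:R) = w i0 ^+ #|A|.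
Proof.
rewrite (@eq_expectation _ (fun f => \prod_y ((y \in A) ==> (f y == i0))%:R)).
  rewrite (expectation_prod (fun y i => ((y \in A) ==> (i == i0))%:R)).
  rewrite (bigID (mem A)) /= -[RHS]mulr1 -prodr_const; congr (_ * _).
    apply: eq_bigr => y yA; rewrite (bigD1 i0) //= yA eqxx mulr1.
    by rewrite big1 ?addr0 // => i /negbTE ->; rewrite mulr0.
  rewrite big1 // => y /negbTE yA; rewrite -[RHS]w_sum1.
  by apply: eq_bigr => i _; rewrite yA mulr1.
move=> f; case: forallP => [h|h].
  by rewrite big1 // => y _; rewrite h.
case: (pickP (fun y => ~~ ((y \in A) ==> (f y == i0)))) => [y yP|nP].
  by rewrite (bigD1 y) //= (negbTE yP) mul0r.
by case: h => y; move: (nP y); case: (_ ==> _).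
Qed.

End ProductExpectation.

(** * Discrepancy *)

Section Discrepancy.
Variable R : realFieldType.

(** Cauchy-Schwarz, summed from [2 * u j * u k <= u j ^+ 2 + u k ^+ 2]; the right side runs over all
    of [J] to become independent of [A]. *)
Lemma sqr_sum_le (J : finType) (A : {set J}) (u : J -> R) :
  (\sum_(j in A) u j) ^+ 2 <= #|J|%:R * \sum_j u j ^+ 2.
Proof.
have le1 : (\sum_(j in A) u j) ^+ 2 <= #|A|%:R * \sum_(j in A) u j ^+ 2.
  have -> : #|A|%:R * \sum_(j in A) u j ^+ 2 =
     \sum_(j in A) \sum_(k in A) (u j ^+ 2 + u k ^+ 2) / 2.
    under [RHS]eq_bigr => j _ do rewrite -mulr_suml big_split /= sumr_const.
    rewrite -mulr_suml big_split /= sumr_const sumrMnl -[X in X + _]mulr_natl -[X in _ + X]mulr_natl.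
    by lra.
  rewrite expr2 big_distrlr /=; apply: ler_sum => j _; apply: ler_sum => k _.
  by have := sqr_ge0 (u j - u k); rewrite sqrrB; lra.
apply: le_trans le1 _; apply: ler_pM.
- exact: ler0n.
- by apply: sumr_ge0 => j _; apply: sqr_ge0.
- by rewrite ler_nat max_card.
rewrite [leRHS](bigID (mem A)) /= lerDl.
by apply: sumr_ge0 => j _; apply: sqr_ge0.
Qed.

(** Cauchy-Schwarz over the rows, then over each of the two column indices: the cut norm of a matrix
    is controlled by its weighted number of 4-cycles, uniformly in [A] and [B]. *)
Lemma bilinear_sum_le (W : finType) (M : W -> W -> R) (A B : {set W}) :
  (\sum_(a in A) \sum_(b in B) M a b) ^+ 4 <=
  #|W|%:R ^+ 4 * \sum_y \sum_y' (\sum_p M p y * M p y') ^+ 2.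
Proof.
set m : R := #|W|%:R; have m0 : 0 <= m by exact: ler0n.
pose c := \sum_(b in B) \sum_(b' in B) \sum_p M p b * M p b'.
have le1 : (\sum_(a in A) \sum_(b in B) M a b) ^+ 2 <= m * c.
  apply: le_trans (sqr_sum_le _ _) _; rewrite -/m ler_wpM2l //.
  rewrite /c; under [leRHS]eq_bigr => b _ do rewrite exchange_big.
  rewrite [leRHS]exchange_big; apply: ler_sum => p _ /=.
  by rewrite expr2 big_distrlr.
have le2 : c ^+ 2 <= m ^+ 2 * \sum_y \sum_y' (\sum_p M p y * M p y') ^+ 2.
  apply: le_trans (sqr_sum_le _ _) _; rewrite -/m expr2 -mulrA ler_wpM2l //.
  rewrite big_distrr; apply: ler_sum => y _ /=; exact: sqr_sum_le.
rewrite [4%N](_ : _ = 2 * 2)%N // !exprM.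
apply: (@le_trans _ _ ((m * c) ^+ 2)).
  by rewrite ler_pXn2r // nnegrE ?sqr_ge0 // (le_trans _ le1) ?sqr_ge0.
by rewrite exprMn [leRHS](_ : _ = m ^+ 2 * (m ^+ 2 * 
  \sum_y \sum_y' (\sum_p M p y * M p y') ^+ 2)) ?ler_wpM2l ?exprn_ge0 //; ring.
Qed.

Variables (W : finType) (op : W -> W -> W).
Hypothesis opC : commutative op.
Hypothesis opK : forall x y, op x (op x y) = y.

Lemma op_inj x : injective (op x).
Proof. by move=> y z /(congr1 (op x)); rewrite !opK. Qed.

(** Quasirandomness of density [beta] for the 0/1 matrix of [op a b \in C], in the sense of the cut
    norm. *)
Definition discrepancy_le (C : {set W}) (beta eps : R) :=
  forall A B : {set W},
  `|\sum_(a in A) \sum_(b in B) (op a b \in C)%:R - beta * #|A|%:R * #|B|%:R|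
    <= eps * #|W|%:R ^+ 2.

Variables (I : finType) (w : I -> R).
Hypothesis w_ge0 : forall i, 0 <= w i.
Hypothesis w_sum1 : \sum_i w i = 1.

Definition centered (f : {ffun W -> I}) (i : I) (x : W) : R :=
  (f x == i)%:R - w i.

(** The weighted count of 4-cycles in the centered matrix; expanding the square gives a sum over
    rectangles with sides [p, p'] and [y, y']. *)
Definition codegree_energy (f : {ffun W -> I}) (i : I) : R :=
  \sum_y \sum_y'
    (\sum_p centered f i (op p y) * centered f i (op p y')) ^+ 2.

Lemma codegree_energy_ge0 f i : 0 <= codegree_energy f i.
Proof.
by apply: sumr_ge0 => y _; apply: sumr_ge0 => y' _; apply: sqr_ge0.
Qed.

(** The deviation is the bilinear sum of the centered matrix; its fourth power is at most [#|W| ^ 4]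
    times the energy, hence at most the fourth power of [eps * #|W| ^ 2]. *)
Lemma discrepancy_of_energy f i eps : 0 <= eps ->
  codegree_energy f i <= eps ^+ 4 * #|W|%:R ^+ 4 ->
  discrepancy_le [set x | f x == i] (w i) eps.
Proof.
move=> eps0 le_energy A B; set m : R := #|W|%:R in le_energy *.
have m0 : 0 <= m by exact: ler0n.
have -> : \sum_(a in A) \sum_(b in B) (op a b \in [set x | f x == i])%:R -
    w i * #|A|%:R * #|B|%:R =
    \sum_(a in A) \sum_(b in B) centered f i (op a b).
  have -> : w i * #|A|%:R * #|B|%:R = \sum_(a in A) \sum_(b in B) w i.
    by rewrite !sumr_const -[RHS]mulr_natr -[X in _ = X * _]mulr_natr mulrAC.
  rewrite -sumrB; apply: eq_bigr => a _; rewrite -sumrB.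
  by apply: eq_bigr => b _; rewrite inE.
rewrite -(@ler_pXn2r _ 4) ?nnegrE ?normr_ge0 ?mulr_ge0 ?exprn_ge0 //.
rewrite -normrX ger0_norm; last by rewrite (exprM _ 2 2) sqr_ge0.
apply: le_trans (bilinear_sum_le _ _ _) _; rewrite -/m.
apply: le_trans (ler_wpM2l _ le_energy) _; first by rewrite exprn_ge0.
by rewrite le_eqVlt; apply/orP; left; apply/eqP; ring.
Qed.

Lemma w_le1 i : w i <= 1.
Proof. by rewrite -w_sum1 (bigD1 i) //= lerDl sumr_ge0. Qed.

Lemma centered_norm f i x : `|centered f i x| <= 1.
Proof.
rewrite /centered ler_norml; have := w_ge0 i; have := w_le1 i.
by case: (_ == _) => /=; lra.
Qed.

(* If [op p y] differs from the other three points then its centered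
   indicator is independent of the rest of the product. *)
Lemma expectation_rectangle i p p' y y' :
  expectation w (fun f => centered f i (op p y) * centered f i (op p y') *
    (centered f i (op p' y) * centered f i (op p' y'))) <=
  (y == y')%:R + (p == p')%:R + (op p y == op p' y')%:R.
Proof.
have le1 : expectation w (fun f => centered f i (op p y) * centered f i (op p y') *
    (centered f i (op p' y) * centered f i (op p' y'))) <= 1.
  rewrite -[leRHS](expectation_cst W w_sum1 1).
  apply: ler_expectation => // f; apply: le_trans (ler_norm _) _.
  by rewrite !normrM !mulr_ile1 ?mulr_ge0 ?normr_ge0 ?centered_norm.
have one (a b c : bool) : [|| a, b | c] -> 1 <= a%:R + b%:R + c%:R :> R.
  by rewrite -!natrD ler1n !addn_gt0 !lt0b orbA.
have [yy'|yy'] := eqVneq y y'; first by apply: le_trans le1 _; apply: one.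
have [pp'|pp'] := eqVneq p p'; first by apply: le_trans le1 _; apply: one; rewrite orbT.
have [ad|ad] := eqVneq (op p y) (op p' y').
  by apply: le_trans le1 _; apply: one; rewrite !orbT.
rewrite (@eq_expectation _ _ _ _ _ (fun f => centered f i (op p y) *
   (centered f i (op p y') * (centered f i (op p' y) * centered f i (op p' y')))));
  last by move=> f; rewrite -mulrA.
rewrite (@expectation_indep _ _ _ _ w_sum1 (pred1 (op p y))).
- rewrite (expectation_coord w_sum1 (op p y) (fun j => (j == i)%:R - w i)).
  have -> : \sum_j w j * ((j == i)%:R - w i) = 0; last by rewrite mul0r /= !addr0.
  under eq_bigr => j _ do rewrite mulrBr.
  rewrite sumrB -mulr_suml w_sum1 mul1r (bigD1 i) //= eqxx mulr1 big1 ?addr0 ?subrr //.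
  by move=> j /negbTE ->; rewrite mulr0.
- by move=> f f' ff'; rewrite /centered ff' ?inE.
move=> f f' ff'; rewrite /centered !ff' ?inE // eq_sym //.
- by apply: contra_neq pp'; rewrite ![op _ y]opC => /op_inj.
- by apply: contra_neq yy' => /op_inj.
Qed.

Lemma sum_delta (T : finType) (x : T) : \sum_y (y == x)%:R = 1 :> R.
Proof. by rewrite (bigD1 x) //= eqxx big1 ?addr0 // => y /negbTE ->. Qed.

(** Only rectangles with one of three coincidences can contribute. Each coincidence leaves
    [#|W| ^ 3] quadruples, the third because [op p y = op p' y'] determines [p']. *)
Lemma expectation_energy i :
  expectation w (fun f => codegree_energy f i) <= 3 * #|W|%:R ^+ 3.
Proof.
rewrite /codegree_energy expectation_sum.
under eq_bigr => y _.
  rewrite expectation_sum.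
  under eq_bigr => y' _.
    rewrite (@eq_expectation _ _ _ _ _ (fun f =>
      \sum_p \sum_p' centered f i (op p y) * centered f i (op p y') *
       (centered f i (op p' y) * centered f i (op p' y')))); last first.
      by move=> f; rewrite expr2 big_distrlr.
    rewrite expectation_sum.
    under eq_bigr => p _ do rewrite expectation_sum.
    over.
  over.
apply: (@le_trans _ _ (\sum_y \sum_y' \sum_p \sum_p'
   ((y == y')%:R + (p == p')%:R + (op p y == op p' y')%:R))).
  apply: ler_sum => y _; apply: ler_sum => y' _; apply: ler_sum => p _.
  by apply: ler_sum => p' _; apply: expectation_rectangle.
have cst (c : R) : \sum_(x : W) c = #|W|%:R * c by rewrite sumr_const mulr_natl.
have d1 y y' p : \sum_p' ((y == y')%:R + (p == p')%:R + (op p y == op p' y')%:R) =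
    #|W|%:R * (y == y')%:R + 1 + 1 :> R.
  rewrite !big_split /= cst; congr (_ + _ + _).
    by under eq_bigr => ? _ do rewrite eq_sym; rewrite sum_delta.
  rewrite -[RHS](sum_delta (op y' (op p y))); apply: eq_bigr => p' _.
  congr (nat_of_bool _)%:R; apply/eqP/eqP => [->|->].
    by rewrite [op p' y']opC opK.
  by rewrite [RHS]opC opK.
have d2 y : \sum_y' (y == y')%:R = 1 :> R.
  by under eq_bigr => ? _ do rewrite eq_sym; rewrite sum_delta.
under eq_bigr => y _ do under eq_bigr => y' _ do
  under eq_bigr => p _ do rewrite d1.
under eq_bigr => y _.
  under eq_bigr => y' _ do rewrite cst.
  rewrite -mulr_sumr !big_split /= -mulr_sumr d2 !cst; over.
rewrite cst le_eqVlt; apply/orP; left; apply/eqP; ring.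
Qed.

End Discrepancy.

(** * The reserve *)

Lemma card_bigcup_le (J T : finType) (A : {set J}) (F : J -> {set T}) k :
  (forall j, j \in A -> #|F j| <= k)%N -> (#|\bigcup_(j in A) F j| <= #|A| * k)%N.
Proof.
move=> Fk; apply: (@leq_trans (\sum_(j in A) #|F j|)); last first.
  by rewrite -sum_nat_const; apply: leq_sum.
elim/big_rec2: _ => [|j n B _ IH]; first by rewrite cards0.
by apply: leq_trans (leq_card_setU _ _) _; rewrite leq_add2l.
Qed.

Section Reserve.
Variables (R : realFieldType) (W : finType) (op : W -> W -> W).
Hypothesis opC : commutative op.
Hypothesis opK : forall x y, op x (op x y) = y.
Variable d : nat.
Implicit Type u : {ffun 'I_d -> W}.

(** Whether [q] is a candidate for [u] is decided by the labels of these points. *)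
Definition footprint u (q : W) : {set W} := q |: [set op q (u j) | j : 'I_d].

Lemma card_footprint u q : (#|footprint u q| <= d.+1)%N.
Proof.
rewrite /footprint cardsU1 -add1n leq_add ?leq_b1 //.
by apply: leq_trans (leq_imset_card _ _) _; rewrite card_ord.
Qed.

(** This follows from [op (op q u) u = q]. Hence a point lies in at most [d.+1] footprints. *)
Lemma footprint_sym u q x : x \in footprint u q -> q \in footprint u x.
Proof.
rewrite !inE => /orP[/eqP->|/imsetP[j _ ->]]; first by rewrite eqxx.
apply/orP; right; apply/imsetP; exists j => //.
by rewrite [RHS]opC [op q _]opC opK.
Qed.

(** Take a maximal family. The footprint of any point meets that of a member, so the point is two
    footprint steps away from this member, and each member accounts for at most [d.+1 ^ 2]
    points. *)
Lemma disjoint_footprints u : exists S : {set W},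
  (forall q q', q \in S -> q' \in S -> q != q' ->
     [disjoint footprint u q & footprint u q']) /\
  (#|W| <= #|S| * d.+1 ^ 2)%N.
Proof.
pose P (S : {set W}) := [forall q in S, forall q' in S, (q != q') ==>
     [disjoint footprint u q & footprint u q']].
have P0 : P set0 by apply/forallP => q; rewrite inE.
have [S /maxsetP[PS maxS] _] := maxset_exists P0.
have PSP q q' : q \in S -> q' \in S -> q != q' ->
     [disjoint footprint u q & footprint u q'].
  by move=> qS q'S qq'; move/forall_inP: PS => /(_ q qS) /forall_inP /(_ q' q'S) /implyP; apply.
exists S; split=> //.
have cover : [set: W] \subset
    \bigcup_(q in S) \bigcup_(x in footprint u q) footprint u x.
  apply/subsetP => v _.
  have [q qS /pred0Pn[x /andP[/= xv xq]]] : exists2 q, q \in S &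
      ~~ [disjoint footprint u v & footprint u q].
    have [vS|vS] := boolP (v \in S).
      by exists v => //; apply/pred0Pn; exists v; rewrite /= !inE eqxx.
    apply/exists_inP; apply: contraT => /exists_inPn nv.
    have : P (v |: S).
      apply/forall_inP => q1 q1S; apply/forall_inP => q2 q2S; apply/implyP => q12.
      move: q1S q2S; rewrite !inE => /orP[/eqP e1|q1S] /orP[/eqP e2|q2S].
      - by rewrite e1 e2 eqxx in q12.
      - by rewrite e1; have := nv _ q2S; rewrite negbK.
      - by rewrite e2 disjoint_sym; have := nv _ q1S; rewrite negbK.
      - exact: PSP.
    move=> /maxS /(_ (subsetUr _ _)) vS'; move: vS; rewrite -vS'.
    by rewrite setU11.
  by apply/bigcupP; exists q => //; apply/bigcupP; exists x => //; apply: footprint_sym.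
rewrite -cardsT; apply: leq_trans (subset_leq_card cover) _.
apply: card_bigcup_le => q _.
apply: leq_trans (card_bigcup_le (k := d.+1) _) _.
  by move=> x _; apply: card_footprint.
by rewrite -mulnn leq_mul2r card_footprint orbT.
Qed.

Variables (I : finType) (w : I -> R) (i0 : I).
Hypothesis w_ge0 : forall i, 0 <= w i.
Hypothesis w_sum1 : \sum_i w i = 1.

Definition candidates u (f : {ffun W -> I}) : {set W} :=
  [set q | [forall x in footprint u q, f x == i0]].

(** An exponential moment: every candidate in [S] contributes a factor 1/2. Events on disjoint
    footprints are independent, and each [q] is a candidate with probability at least
    [w i0 ^+ d.+1]. *)
Lemma expectation_footprints u (S : {set W}) :
  (forall q q', q \in S -> q' \in S -> q != q' ->
     [disjoint footprint u q & footprint u q']) ->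
  expectation w (fun f => \prod_(q in S) (1 - (q \in candidates u f)%:R / 2)) <=
  (1 - w i0 ^+ d.+1 / 2) ^+ #|S|.
Proof.
move: {2}#|S| (erefl #|S|) => k; elim: k S => [|k IH] S cS dS.
  have S0 : S = set0 by apply/eqP; rewrite -cards_eq0 cS.
  rewrite cS expr0 S0 (@eq_expectation _ _ _ _ _ (fun=> 1)) ?expectation_cst //.
  by move=> f; rewrite big_set0.
have /card_gt0P[s sS] : (0 < #|S|)%N by rewrite cS.
have cS' : #|S :\ s| = k by move: cS; rewrite (cardsD1 s) sS => -[].
have w1 := w_le1 w_ge0 w_sum1 i0; have w0 := w_ge0 i0.
have wX1 n : w i0 ^+ n <= 1 by apply: exprn_ile1.
have wX0 n : 0 <= w i0 ^+ n by apply: exprn_ge0.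
rewrite (@eq_expectation _ _ _ _ _ (fun f => (1 - (s \in candidates u f)%:R / 2) *
   \prod_(q in S :\ s) (1 - (q \in candidates u f)%:R / 2))); last first.
  move=> f; rewrite (bigD1 s) //=; congr (_ * _); apply: eq_bigl => q.
  by rewrite !inE andbC.
rewrite (@expectation_indep _ _ _ _ w_sum1 (mem (footprint u s))).
- rewrite cS exprS; apply: ler_pM.
  + rewrite -(expectation_cst W w_sum1 0); apply: ler_expectation => // f.
    by case: (_ \in _) => /=; lra.
  + rewrite -(expectation_cst W w_sum1 0); apply: ler_expectation => // f.
    by apply: prodr_ge0 => q _; case: (_ \in _) => /=; lra.
  + rewrite (@eq_expectation _ _ _ _ _ (fun f => 1 + (- 2^-1) *
        [forall x in footprint u s, f x == i0]%:R)); last first.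
      by move=> f; rewrite inE; lra.
    rewrite expectationD expectationZ expectation_cst // expectation_block //.
    have : w i0 ^+ d.+1 <= w i0 ^+ #|footprint u s|.
      by apply: ler_wiXn2l => //; apply: card_footprint.
    by lra.
  + by rewrite -cS'; apply: IH => // q q'; rewrite !inE => /andP[_ ?] /andP[_ ?]; apply: dS.
- move=> f f' ff'; rewrite !inE; congr (1 - (nat_of_bool _)%:R / 2).
  by apply: eq_forallb_in => x xs; rewrite ff'.
- move=> f f' ff'; apply: eq_bigr => q; rewrite !inE => /andP[qs qS].
  congr (1 - (nat_of_bool _)%:R / 2); apply: eq_forallb_in => x xq; rewrite ff' //.
  have := dS _ _ qS sS qs; rewrite disjoint_subset => /subsetP /(_ x xq).
  by rewrite inE.
Qed.

(** Exponential Markov inequality: if there are at most [a] candidates, the product in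
    [expectation_footprints] is at least [2 ^- a], while with [a * h] disjoint footprints its mean
    is at most [4^-1 ^+ a]. *)
Lemma candidates_tail u a h :
  (a * h * d.+1 ^ 2 <= #|W|)%N -> (1 - w i0 ^+ d.+1 / 2) ^+ h <= 4^-1 ->
  expectation w (fun f => (#|candidates u f| <= a)%N%:R) <= (2 ^- a).
Proof.
move=> aW hh.
have [S [dS cS]] := disjoint_footprints u.
have w1 := w_le1 w_ge0 w_sum1 i0; have w0 := w_ge0 i0.
have wX1 : w i0 ^+ d.+1 <= 1 by apply: exprn_ile1.
have wX0 : 0 <= w i0 ^+ d.+1 by apply: exprn_ge0.
set kap := 1 - _ in hh.
have k0 : 0 <= kap by rewrite /kap; lra.
have k1 : kap <= 1 by rewrite /kap; lra.
have ahS : (a * h <= #|S|)%N.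
  by rewrite -(@leq_pmul2r (d.+1 ^ 2)) ?expn_gt0 //; apply: leq_trans aW cS.
apply: (@le_trans _ _ (2 ^+ a * kap ^+ #|S|)).
  have p2 : 0 <= 2 ^+ a :> R by rewrite exprn_ge0.
  apply: le_trans (ler_wpM2l p2 (expectation_footprints dS)).
  rewrite -expectationZ; apply: ler_expectation => // f.
  have -> : \prod_(q in S) (1 - (q \in candidates u f)%:R / 2) =
     2^-1 ^+ #|S :&: candidates u f| :> R.
    rewrite (bigID (mem (candidates u f))) /= [X in _ * X]big1; last first.
      by move=> q /andP[_ /negbTE ->]; rewrite mul0r subr0.
    rewrite mulr1 -prodr_const (eq_bigl (fun q => q \in S :&: candidates u f)); last first.
      by move=> q; rewrite in_setI.
    by apply: eq_bigr => q; rewrite in_setI => /andP[_ ->] /=; lra.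
  case: leqP => [le|_] /=; last by rewrite mulr_ge0 ?exprn_ge0 ?invr_ge0.
  rewrite exprVn -ler_pdivrMl ?exprn_gt0 // mulr1 lef_pV2 ?posrE ?exprn_gt0 //.
  rewrite ler_weXn2l ?ler1n //; apply: leq_trans le; apply: subset_leq_card.
  exact: subsetIr.
have le1 : kap ^+ #|S| <= (4^-1) ^+ a.
  apply: (@le_trans _ _ (kap ^+ (a * h))); first exact: ler_wiXn2l.
  by rewrite mulnC exprM lerXn2r ?nnegrE ?exprn_ge0 ?invr_ge0.
apply: le_trans (ler_wpM2l _ le1) _; first by rewrite exprn_ge0.
by rewrite -exprMn -exprVn lerXn2r ?nnegrE; lra.
Qed.

End Reserve.

(** * Existence of a good labelling *)

Lemma leq_expn2r n a b : (a <= b -> a ^ n <= b ^ n)%N.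
Proof. by case: n => // n ab; rewrite leq_exp2r. Qed.

(** With [b = a %/ d.+1], the power [2 ^ a] is at least [b.+1 ^ d.+1]; [d] of these factors match
    the polynomial and the last one beats the constant. *)
Lemma exp2_gt_poly (K d : nat) :
  exists a0, forall a, (a0 <= a)%N -> (K * a.+1 ^ d < 2 ^ a)%N.
Proof.
exists (d.+1 * (K * d.+1 ^ d))%N => a a0a.
set b := (a %/ d.+1)%N.
have bK : (K * d.+1 ^ d <= b)%N by rewrite /b leq_divRL // mulnC.
have ab : (a.+1 <= d.+1 * b.+1)%N by rewrite mulnC /b ltn_ceil.
have ba : (b * d.+1 <= a)%N by rewrite /b leq_divM.
apply: (@leq_ltn_trans (K * (d.+1 * b.+1) ^ d)).
  by rewrite leq_mul2l leq_expn2r ?orbT.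
apply: (@leq_trans (2 ^ (b * d.+1))); last by rewrite leq_exp2l.
rewrite expnMn mulnA expnM.
apply: (@leq_trans (b.+1 ^ d.+1)); last by rewrite leq_exp2r // ltn_expl.
by rewrite [in leqRHS]expnS ltn_mul2r expn_gt0 /= ltnS.
Qed.

(** Bernoulli gives [4 <= (1 + kap) ^+ h] once [h] exceeds [4 / kap], and
    [(1 - kap) * (1 + kap) <= 1]. *)
Lemma pow_lt_quarter (R : archiRealFieldType) (kap : R) : 0 < kap -> kap <= 1 ->
  exists2 h, (0 < h)%N & (1 - kap) ^+ h <= 4^-1.
Proof.
move=> k0 k1.
have bern h : 1 + h%:R * kap <= (1 + kap) ^+ h.
  elim: h => [|h IH]; first by rewrite mul0r addr0 expr0.
  rewrite exprS -natr1; have : 0 <= h%:R :> R by exact: ler0n.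
  by move: IH; set x := (1 + kap) ^+ h; nra.
pose h := (Num.truncn (4 / kap)).+1.
have hP : 4 / kap < h%:R by rewrite truncnS_gt.
exists h => //.
have h4 : 4 <= (1 + kap) ^+ h.
  apply: le_trans (bern h); move: hP; rewrite ltr_pdivrMr //; lra.
have le1 : (1 - kap) ^+ h * (1 + kap) ^+ h <= 1.
  rewrite -exprMn exprn_ile1 //; nra.
have p0 : 0 <= (1 - kap) ^+ h by apply: exprn_ge0; lra.
by nra.
Qed.

(** First moment method for the total energy together with the number of poor tuples [u]. The
    constant [h] comes before [k] and [eps] because the number of levels, and so of labels, is later
    chosen in terms of [h]. *)
Lemma labelling_exists (R : archiRealFieldType) (d : nat) (theta : R) :
  0 < theta -> theta <= 1 ->
  exists2 h : nat, (0 < h)%N &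
  forall (k : nat) (eps : R), 0 < eps -> exists m0 : nat,
  forall (W I : finType) (op : W -> W -> W) (w : I -> R) (i0 : I),
    commutative op -> (forall x y, op x (op x y) = y) ->
    (forall i, 0 <= w i) -> \sum_i w i = 1 -> theta <= w i0 ->
    (#|I| <= k)%N -> (m0 <= #|W|)%N ->
  exists f : {ffun W -> I},
    (forall i, discrepancy_le op [set x | f x == i] (w i) eps) /\
    (forall u : {ffun 'I_d -> W}, #|W| < h * #|candidates op i0 u f|)%N.
Proof.
move=> th0 th1.
have tX0 : 0 < theta ^+ d.+1 by apply: exprn_gt0.
have tX1 : theta ^+ d.+1 <= 1 by apply: exprn_ile1 => //; apply: ltW.
have [h' h'0 h'P] : exists2 h, (0 < h)%N & (1 - theta ^+ d.+1 / 2) ^+ h <= 4^-1.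
  by apply: pow_lt_quarter; lra.
pose h := (h' * d.+1 ^ 2)%N.
have h0 : (0 < h)%N by rewrite muln_gt0 h'0 expn_gt0.
exists h => // k eps eps0.
(* With [a = m %/ h] below, the [m ^ d] tuples number at most [h ^ d * a.+1 ^ d]; the factor 2 makes
   their total failure probability, at most [m ^ d / 2 ^ a], less than 1/2. *)
have [a0 a0P] := exp2_gt_poly (2 * h ^ d) d.
(* From [m1] on, the expected total energy [3 * k * m ^ 3] is at most half of [eps ^ 4 * m ^ 4]. *)
pose m1 := (Num.truncn ((6 * k%:R) / eps ^+ 4)).+1.
exists (h * a0 + m1)%N => W I op w i0 opC opK w_ge0 w_sum1 th_w cI cW.
set m := #|W| in cW *.
pose a := (m %/ h)%N.
have a0a : (a0 <= a)%N by rewrite leq_divRL // mulnC (leq_trans _ cW) // leq_addr.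
have mb : (m < h * a.+1)%N by rewrite mulnC ltn_ceil.
have m0 : 0 < m%:R :> R by rewrite ltr0n (leq_trans _ cW) // /m1 addnS.
have e40 : 0 < eps ^+ 4 by apply: exprn_gt0.
have w1 := w_le1 w_ge0 w_sum1 i0; have w0 := w_ge0 i0.
have wX1 : w i0 ^+ d.+1 <= 1 by apply: exprn_ile1.
have twX : theta ^+ d.+1 <= w i0 ^+ d.+1.
  by rewrite ler_pXn2r ?nnegrE // ltW.
have h'w : (1 - w i0 ^+ d.+1 / 2) ^+ h' <= 4^-1.
  by apply: le_trans h'P; rewrite lerXn2r ?nnegrE; lra.
pose c := (eps ^+ 4 * m%:R ^+ 4)^-1.
have c0 : 0 < c by rewrite invr_gt0 mulr_gt0 ?exprn_gt0.
(* [G f < 1] bounds every single energy by [c^-1] and excludes every poor tuple, since one such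
   tuple already counts 1. *)
pose G (f : {ffun W -> I}) := c * \sum_i codegree_energy op w f i +
  \sum_(u : {ffun 'I_d -> W}) (#|candidates op i0 u f| <= a)%N%:R.
have EG : expectation w G < 1.
  rewrite /G expectationD expectationZ !expectation_sum.
  have le1 : c * \sum_i expectation w (fun f => codegree_energy op w f i) <= 2^-1.
    apply: (@le_trans _ _ (c * (k%:R * (3 * m%:R ^+ 3)))).
      rewrite ler_pM2l //; apply: (@le_trans _ _ (\sum_(i : I) (3 * m%:R ^+ 3))).
        by apply: ler_sum => i _; apply: expectation_energy.
      rewrite sumr_const -[leLHS]mulr_natl; apply: ler_wpM2r.
        by rewrite mulr_ge0 ?exprn_ge0 // ltW.
      by rewrite ler_nat.
    rewrite /c ler_pdivrMl ?mulr_gt0 ?exprn_gt0 //.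
    have : 6 * k%:R / eps ^+ 4 <= m%:R.
      apply: (@le_trans _ _ m1%:R); first by rewrite ltW // truncnS_gt.
      by rewrite ler_nat (leq_trans _ cW) // leq_addl.
    rewrite ler_pdivrMr // => le6.
    have m3 : 0 < m%:R ^+ 3 :> R by apply: exprn_gt0.
    by have := ler_wpM2r (ltW m3) le6; rewrite (exprS _ 3); lra.
  have lt2 : \sum_(u : {ffun 'I_d -> W})
     expectation w (fun f => (#|candidates op i0 u f| <= a)%N%:R) < 2^-1.
    apply: (@le_lt_trans _ _ (\sum_(u : {ffun 'I_d -> W}) 2 ^- a)).
      apply: ler_sum => u _; apply: (@candidates_tail _ _ _ _ _ _ _ _ _ _ _ _ _ h') => //.
      by rewrite -mulnA -/h /a leq_divM.
    rewrite sumr_const card_ffun card_ord -/m -[ltLHS]mulr_natl ltr_pdivrMr ?exprn_gt0 //.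
    rewrite mulrC ltr_pdivlMr // -natrX -natrM ltr_nat.
    apply: leq_ltn_trans (a0P _ a0a).
    by rewrite mulnC -mulnA leq_mul2l /= -expnMn leq_expn2r // ltnW.
  by lra.
have [f Gf] := expectation_lt_ex w_ge0 w_sum1 EG.
have sum0 : 0 <= \sum_(u : {ffun 'I_d -> W}) (#|candidates op i0 u f| <= a)%N%:R :> R.
  by apply: sumr_ge0 => u _; apply: ler0n.
have en0 : 0 <= c * \sum_i codegree_energy op w f i.
  by rewrite mulr_ge0 ?(ltW c0) // sumr_ge0 // => i _; apply: codegree_energy_ge0.
exists f; split=> [i|u].
  apply: discrepancy_of_energy; first exact: ltW.
  rewrite -/m -[leRHS]mulr1 -ler_pdivrMl ?mulr_gt0 ?exprn_gt0 // -/c.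
  apply: (@le_trans _ _ (c * \sum_i codegree_energy op w f i)); last first.
    by move: Gf; rewrite /G; lra.
  rewrite ler_pM2l // (bigD1 i) //= lerDl sumr_ge0 // => j _.
  exact: codegree_energy_ge0.
apply: (@leq_trans (h * a.+1)) => //; rewrite leq_pmul2l // ltnNge.
apply/negP => le; move: Gf; rewrite /G (bigD1 u) //= le /=.
have : 0 <= \sum_(i | i != u) (#|candidates op i0 i f| <= a)%N%:R :> R.
  by apply: sumr_ge0 => ? _; apply: ler0n.
by lra.
Qed.

(** * Augmenting paths *)

Section Augmentation.
Local Open Scope nat_scope.
Variables (W E : finType) (op : W -> W -> W).
Hypothesis opC : commutative op.
Hypothesis opK : forall x y, op x (op x y) = y.
Variables (C : {set E}) (tgt : E -> option W) (Y Z : {set W}).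

Definition assignment := E -> option (W * W).

(** The pair of [e] holds the positions of its lower end and of its private vertex, and [tgt e] that
    of its upper end. With [tgt e = None] the upper end is not placed and any free pair will do. *)
Definition valid (M : assignment) : Prop :=
  [/\ forall e a b, M e = Some (a, b) -> [/\ e \in C, a \in Y & b \in Z],
      forall e a b p, M e = Some (a, b) -> tgt e = Some p -> op p a = b,
      forall e e' a b b', M e = Some (a, b) -> M e' = Some (a, b') -> e = e' &
      forall e e' a a' b, M e = Some (a, b) -> M e' = Some (a', b) -> e = e'].

Definition unassigned (M : assignment) : {set E} := [set e in C | M e == None].

Definition freeY (M : assignment) : {set W} :=
  [set y in Y | [forall e, ~~ [exists z, M e == Some (y, z)]]].
Definition freeZ (M : assignment) : {set W} :=
  [set z in Z | [forall e, ~~ [exists y, M e == Some (y, z)]]].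

Lemma freeYP M y : reflect (y \in Y /\ forall e z, M e <> Some (y, z)) (y \in freeY M).
Proof.
rewrite inE; apply: (iffP andP) => -[yY h]; split=> //.
  move=> e z Me; move/forallP/(_ e)/negP: h; apply; apply/existsP.
  by exists z; apply/eqP.
by apply/forallP => e; apply/negP => /existsP[z /eqP]; apply: h.
Qed.

Lemma freeZP M z : reflect (z \in Z /\ forall e y, M e <> Some (y, z)) (z \in freeZ M).
Proof.
rewrite inE; apply: (iffP andP) => -[yY h]; split=> //.
  move=> e y Me; move/forallP/(_ e)/negP: h; apply; apply/existsP.
  by exists y; apply/eqP.
by apply/forallP => e; apply/negP => /existsP[y /eqP]; apply: h.
Qed.

Definition assign (M : assignment) e1 x : assignment :=
  fun e => if e == e1 then x else M e.

Lemma valid_assign M e a b : valid M -> e \in C -> a \in freeY M -> b \in freeZ M ->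
  (forall p, tgt e = Some p -> op p a = b) -> valid (assign M e (Some (a, b))).
Proof.
move=> [M1 M2 M3 M4] eC /freeYP[aY aF] /freeZP[bZ bF] ep; split.
- by move=> e' a' b'; rewrite /assign; case: eqP => [-> [<- <-]|_ /M1].
- by move=> e' a' b' p; rewrite /assign; case: eqP => [-> [<- <-] /ep|_ /M2 h /h].
- move=> e1 e2 a' b' b''; rewrite /assign.
  case: eqP => [-> [<- _]|_]; case: eqP => [-> //|_].
  + by move=> /aF.
  + by move=> h [? _]; subst a'; case: (aF _ _ h).
  + exact: M3.
- move=> e1 e2 a' a'' b'; rewrite /assign.
  case: eqP => [-> [_ <-]|_]; case: eqP => [-> //|_].
  + by move=> /bF.
  + by move=> h [_ ?]; subst b'; case: (bF _ _ h).
  + exact: M4.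
Qed.

Lemma unassigned_assign M e x : e \in C -> M e = None ->
  #|unassigned (assign M e (Some x))|.+1 = #|unassigned M|.
Proof.
move=> eC Me; rewrite (cardsD1 e (unassigned M)) !inE eC Me eqxx add1n; congr _.+1.
by apply: eq_card => e'; rewrite !inE /assign; case: (e' =P e) => //; rewrite andbF.
Qed.

Lemma card_freeY M : valid M -> #|Y| <= #|freeY M| + (#|C| - #|unassigned M|).
Proof.
move=> [M1 _ M3 _].
have -> : #|C| - #|unassigned M| = #|C :\: unassigned M|.
  rewrite cardsD; congr (_ - _); apply: eq_card => e; rewrite !inE.
  by case: (e \in C).
rewrite -(cardsID (freeY M) Y); apply: leq_add.
  by apply: subset_leq_card; apply: subsetIr.
have [/existsP[x0 _]|n0] := boolP [exists x, x \in Y :\: freeY M]; last first.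
  rewrite (_ : Y :\: _ = set0) ?cards0 //; apply/setP => x; rewrite in_set0.
  by apply/negbTE; apply: contra n0 => xx; apply/existsP; exists x.
pose h e := if M e is Some (a, _) then a else x0.
apply: leq_trans (leq_imset_card h _); apply: subset_leq_card.
apply/subsetP => y; rewrite in_setD => /andP[yF yY].
have /existsP[e /existsP[z /eqP Me]] : [exists e, [exists z, M e == Some (y, z)]].
  apply: contraR yF; rewrite negb_exists => /forallP nF.
  by rewrite inE yY /=; apply/forallP.
apply/imsetP; exists e; last by rewrite /h Me.
by case: (M1 _ _ _ Me) => eC _ _; rewrite !inE Me eC.
Qed.

Lemma card_freeZ M : valid M -> #|Z| <= #|freeZ M| + (#|C| - #|unassigned M|).
Proof.
move=> [M1 _ _ M4].
have -> : #|C| - #|unassigned M| = #|C :\: unassigned M|.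
  rewrite cardsD; congr (_ - _); apply: eq_card => e; rewrite !inE.
  by case: (e \in C).
rewrite -(cardsID (freeZ M) Z); apply: leq_add.
  by apply: subset_leq_card; apply: subsetIr.
have [/existsP[x0 _]|n0] := boolP [exists x, x \in Z :\: freeZ M]; last first.
  rewrite (_ : Z :\: _ = set0) ?cards0 //; apply/setP => x; rewrite in_set0.
  by apply/negbTE; apply: contra n0 => xx; apply/existsP; exists x.
pose h e := if M e is Some (_, b) then b else x0.
apply: leq_trans (leq_imset_card h _); apply: subset_leq_card.
apply/subsetP => z; rewrite in_setD => /andP[zF zZ].
have /existsP[e /existsP[y /eqP Me]] : [exists e, [exists y, M e == Some (y, z)]].
  apply: contraR zF; rewrite negb_exists => /forallP nF.
  by rewrite inE zZ /=; apply/forallP.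
apply/imsetP; exists e; last by rewrite /h Me.
by case: (M1 _ _ _ Me) => eC _ _; rewrite !inE Me eC.
Qed.

(** When [P] consists of unassigned targets, each [y] counted here can be paired with [z] to embed
    the edge waiting at [op y z]. *)
Definition heavy (T : nat) (P A : {set W}) : {set W} :=
  [set z in Z | T < #|[set y in A | op y z \in P]|].

Section Path.
Variables (M : assignment) (T : nat).
Hypothesis M_valid : valid M.

Definition targets : {set W} :=
  [set p | [exists e, (e \in unassigned M) && (tgt e == Some p)]].

(** The points of [Y] that are free or can be freed by at most [i] switches, each handing the
    partner [z] of an occupied point to an unassigned edge. *)
Fixpoint freeable (i : nat) : {set W} :=
  if i is j.+1 then
    freeY M :|: [set y in Y | [exists e, [exists z,
      (M e == Some (y, z)) && (z \in heavy T targets (freeable j))]]]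
  else freeY M.

Lemma heavyS P (A B : {set W}) : A \subset B -> heavy T P A \subset heavy T P B.
Proof.
move=> AB; apply/subsetP => z; rewrite !inE => /andP[-> h] /=.
apply: leq_trans h _; apply: subset_leq_card; apply/subsetP => y.
by rewrite !inE => /andP[/(subsetP AB) -> ->].
Qed.

Lemma freeableS i : freeable i \subset freeable i.+1.
Proof.
elim: i => [|i IH]; first by rewrite /= subsetUl.
rewrite /= setUS //; apply/subsetP => y; rewrite !inE => /andP[-> /=].
move=> /existsP[e /existsP[z /andP[Me hz]]]; apply/existsP; exists e.
by apply/existsP; exists z; rewrite Me /=; apply: (subsetP (heavyS _ IH)).
Qed.

Lemma freeableY i : freeable i \subset Y.
Proof.
have f0 : freeY M \subset Y by apply/subsetP => y /freeYP[].
case: i => [|i] //=; rewrite subUset f0 /=.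
by apply/subsetP => y; rewrite inE => /andP[].
Qed.

(* The switch [(p, y, z) -> (q, y', z)] with [q] an unassigned target and [y']
   freeable one step earlier frees [y]; heaviness of [z] leaves room to avoid
   the targets [B] that the rest of the path has to keep. *)
Lemma switching i y (B : {set W}) : y \in freeable i -> #|B| + i <= T ->
  exists M', [/\ valid M', y \in freeY M', freeZ M \subset freeZ M' &
   [/\ forall e a b, M e = Some (a, b) -> a \notin freeable i -> M' e = Some (a, b),
       forall e p, e \in C -> M e = None -> tgt e = Some p -> p \in B -> M' e = None &
       #|unassigned M'| = #|unassigned M|]].
Proof.
elim: i y B => [|i IH] y B yF cB; first by exists M.
have [yi|yi] := boolP (y \in freeable i).
  have [|M' [v1 v2 v3 [v4 v5 v6]]] := IH _ B yi; first by lia.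
  exists M'; split=> //; split=> // e a b Me aF; apply: v4 => //.
  by apply: contra aF; apply: (subsetP (freeableS i)).
move: (yF); rewrite /= inE => /orP[y0|].
  exists M; split=> //.
rewrite inE => /andP[yY /existsP[e0 /existsP[z /andP[/eqP Me0 hz]]]].
move: hz; rewrite inE => /andP[zZ]; set H := [set _ in _ | _] => cH.
(* A point [y'] whose target [op y' z] is [p] equals [op z p], so [B] spoils at most [#|B|] points
   of [H], fewer than [H] has. *)
have : ~~ (H \subset [set op z p | p in B]).
  apply/negP => /subset_leq_card; rewrite leqNgt => /negP; apply.
  by apply: leq_ltn_trans (leq_imset_card _ _) _; lia.
case/subsetPn => y' ; rewrite inE => /andP[y'i qP] qB.
set q := op y' z in qP.
have {}qB : q \notin B.
  apply: contra qB => qB; apply/imsetP; exists q => //.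
  by rewrite /q [op y' z]opC opK.
move: qP; rewrite inE => /existsP[e1 /andP[]]; rewrite inE => /andP[e1C /eqP Me1] /eqP te1.
(* Protecting [q] as well keeps [e1] unassigned while [y'] is being freed; the budget moves from [i]
   to [#|B|]. *)
have [|M' [v1 v2 v3 [v4 v5 v6]]] := IH _ (q |: B) y'i.
  by rewrite cardsU1 qB; lia.
have M'0 := v4 _ _ _ Me0 yi.
have M'1 : M' e1 = None by apply: (v5 _ q) => //; rewrite setU11.
have e01 : e0 != e1 by apply/eqP => h; move: M'0; rewrite h M'1.
have [M1 M2 M3 M4] := v1.
pose M0 := assign M' e0 None.
have v0 : valid M0.
  split.
  - by move=> e a b; rewrite /M0 /assign; case: eqP => // _ /M1.
  - by move=> e a b p; rewrite /M0 /assign; case: eqP => // _ /M2 h /h.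
  - move=> e e' a b b'; rewrite /M0 /assign; case: eqP => // _; case: eqP => // _.
    exact: M3.
  - move=> e e' a a' b; rewrite /M0 /assign; case: eqP => // _; case: eqP => // _.
    exact: M4.
have y'F : y' \in freeY M0.
  case/freeYP: v2 => ? h; apply/freeYP; split=> // e z'.
  by rewrite /M0 /assign; case: eqP => // _ /h.
have zF : z \in freeZ M0.
  apply/freeZP; split=> // e a; rewrite /M0 /assign; case: eqP => // ne Me.
  by apply: ne; apply: M4 Me M'0.
have e0C : e0 \in C by case: (M1 _ _ _ M'0).
exists (assign M0 e1 (Some (y', z))); split.
- apply: valid_assign => // p; rewrite te1 => -[<-].
  by rewrite /q opC opK.
- apply/freeYP; split=> // e z'; rewrite /M0 /assign; case: eqP => [_ [h _]|_].
    by move: yi; rewrite -h y'i.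
  by case: eqP => // ne /M3 /(_ M'0).
- apply/subsetP => b bF; have /freeZP[bZ b'] := subsetP v3 _ bF.
  apply/freeZP; split=> // e a; rewrite /M0 /assign; case: eqP => [_ [_ h]|_].
    by case/freeZP: bF => _ /(_ e0 y); rewrite -h Me0.
  by case: eqP => // _ /b'.
- split.
  + move=> e a b Me aF; rewrite /M0 /assign; case: eqP => [h|_].
      by move: Me; rewrite h Me1.
    case: eqP => [h|_].
      by move: Me aF; rewrite h Me0 => -[<- _]; rewrite yF.
    apply: v4 Me _; apply: contra aF; exact: (subsetP (freeableS i)).
  + move=> e p eC Me te pB; rewrite /M0 /assign; case: eqP => [h|_].
      by move: te pB qB; rewrite h te1 => -[<-] ->.
    by case: eqP => // _; apply: (v5 e p); rewrite // inE pB orbT.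
  have M01 : M0 e1 = None by rewrite /M0 /assign eq_sym (negbTE e01).
  have := unassigned_assign (y', z) e1C M01.
  have : #|unassigned M0| = #|unassigned M'|.+1.
    have := @unassigned_assign M0 e0 (y, z) e0C.
    rewrite {1}/M0 {1}/assign eqxx => /(_ erefl) <-; congr _.+1.
    apply: eq_card => e; rewrite !inE /M0 /assign; case: (e =P e0) => // ->.
    by rewrite M'0.
  by move=> -> [->].
Qed.

End Path.

Variables (N0 T s t : nat).
Hypothesis tgt_inj : forall e e' p, e \in C -> e' \in C ->
  tgt e = Some p -> tgt e' = Some p -> e = e'.
Hypothesis t_lt_s : t < s.
Hypothesis sizeY : #|C| + s <= #|Y|.
Hypothesis sizeZ : #|C| + s <= #|Z|.
Hypothesis T_large : #|Y| < s + T * (s - t).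
Hypothesis expand : forall P A : {set W}, N0 < #|P| -> A \subset Y ->
  #|A| <= #|heavy T P A| + t.

(** An edge without target takes any free pair. Otherwise, if a heavy [z] is free, switching frees a
    partner for it. If no heavy [z] is free, the partners of the heavy points are freeable one step
    later, so by [expand] the freeable set grows by [s - t] in each round, and after [T] rounds it
    outgrows [Y]. *)
Lemma augment_step M : valid M -> N0 < #|unassigned M| ->
  exists2 M', valid M' & #|unassigned M'| < #|unassigned M|.
Proof.
move=> vM cU.
have cY := card_freeY vM; have cZ := card_freeZ vM.
have [/existsP[e /andP[]]|nfree] :=
    boolP [exists e, (e \in unassigned M) && (tgt e == None)].
  rewrite inE => /andP[eC /eqP Me] /eqP te.
  have /card_gt0P[a aF] : 0 < #|freeY M| by lia.
  have /card_gt0P[b bF] : 0 < #|freeZ M| by lia.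
  exists (assign M e (Some (a, b))).
    by apply: valid_assign => // p; rewrite te.
  by rewrite -(unassigned_assign (a, b) eC Me).
set P := targets M.
have cP : N0 < #|P|.
  apply: leq_trans cU _.
  have [/existsP[p0 _]|n0] := boolP [exists p : W, true]; last first.
    rewrite (_ : unassigned M = set0) ?cards0 //; apply/setP => e; rewrite in_set0.
    apply/negbTE/negP => eU; case te: (tgt e) => [p|].
      by move/negP: n0; apply; apply/existsP; exists p.
    by move/negP: nfree; apply; apply/existsP; exists e; rewrite eU te.
  pose h e := odflt p0 (tgt e).
  have hU e : e \in unassigned M -> tgt e = Some (h e).
    move=> eU; rewrite /h; case te: (tgt e) => [p|] //.
    by move/negP: nfree; case; apply/existsP; exists e; rewrite eU te.
  rewrite -(@card_in_imset _ _ h).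
    apply: subset_leq_card; apply/subsetP => p /imsetP[e eU ->].
    by rewrite inE; apply/existsP; exists e; rewrite eU hU /=.
  move=> e e' eU e'U hh; apply: (@tgt_inj _ _ (h e)).
  - by move: eU; rewrite inE => /andP[].
  - by move: e'U; rewrite inE => /andP[].
  - exact: hU.
  - by rewrite hh; exact: hU.
have [/existsP[i /existsP[z /andP[zH zF]]]|nz] := boolP [exists i : 'I_T,
    [exists z, (z \in heavy T P (freeable M T i)) && (z \in freeZ M)]].
  move: zH; rewrite inE => /andP[zZ cH].
  have /card_gt0P[y] : 0 < #|[set y in freeable M T i | op y z \in P]| by lia.
  rewrite inE => /andP[yi]; set q := op y z; rewrite inE => /existsP[e /andP[]].
  rewrite inE => /andP[eC /eqP Me] /eqP te.
  (* As [i < T], there is room for [i] switches and the one protected target [q]. *)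
  have [|M' [v1 v2 v3 [v4 v5 v6]]] := switching vM (B := [set q]) yi.
    by rewrite cards1; have := ltn_ord i; lia.
  have M'e : M' e = None by apply: (v5 e q); rewrite ?set11.
  exists (assign M' e (Some (y, z))).
    apply: valid_assign => //; first exact: (subsetP v3).
    by move=> p; rewrite te => -[<-]; rewrite /q opC opK.
  by rewrite -v6 -(unassigned_assign (y, z) eC M'e).
suff grow i : i <= T -> s + i * (s - t) <= #|freeable M T i|.
  have := grow T (leqnn _); have := subset_leq_card (freeableY M T T); lia.
elim: i => [|i IH] iT; first by rewrite mul0n addn0 /=; lia.
have ex := expand cP (freeableY M T i).
suff : #|freeY M| + #|heavy T P (freeable M T i)| <= #|freeable M T i.+1|.
  have := IH (ltnW iT); lia.
set H := heavy _ _ _ in ex *.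
have Hm z : z \in H -> exists e y, M e = Some (y, z).
  move=> zH; have : z \notin freeZ M.
    apply/negP => zF; move/negP: nz; apply; apply/existsP; exists (Ordinal iT).
    by apply/existsP; exists z; rewrite zH.
  rewrite inE negb_and; case/orP.
    by move: zH; rewrite inE => /andP[->].
  by rewrite negb_forall => /existsP[e]; rewrite negbK => /existsP[y /eqP]; exists e, y.
have [M1 M2 M3 M4] := vM.
have [H0|/set0Pn[z0 z0H]] := eqVneq H set0.
  rewrite H0 cards0 addn0; apply: subset_leq_card; exact: subsetUl.
have [_ [y0 _]] := Hm _ z0H.
pose h z := if [pick x : E * W | M x.1 == Some (x.2, z)] is Some x then x.2 else y0.
have hP z : z \in H -> exists e, M e = Some (h z, z).
  move=> /Hm[e [y Me]]; rewrite /h; case: pickP => [[e' y'] /eqP /= Me'|/(_ (e, y))].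
    by exists e'.
  by rewrite /= Me eqxx.
rewrite -[#|H|](@card_in_imset _ _ h); last first.
  move=> z1 z2 zH1 zH2 hh; have [e Me] := hP z1 zH1; have [e' Me'] := hP z2 zH2.
  rewrite hh in Me; have ee := M3 _ _ _ _ _ Me Me'.
  by move: Me'; rewrite -ee Me => -[].
rewrite -cardsUI [X in _ + X](_ : _ = 0) ?addn0; last first.
  apply/eqP; rewrite cards_eq0; apply/eqP/setP => y; rewrite in_setI in_set0.
  apply/negbTE/negP => /andP[/freeYP[_ yF] /imsetP[z zH yz]].
  by have [e] := hP z zH; rewrite -yz => /yF.
apply: subset_leq_card; rewrite subUset /= subsetUl /=.
apply/subsetP => _ /imsetP[z zH ->]; rewrite inE; apply/orP; right.
have [e Me] := hP z zH; rewrite inE; case: (M1 _ _ _ Me) => _ -> _ /=.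
by apply/existsP; exists e; apply/existsP; exists z; rewrite Me eqxx.
Qed.

Lemma near_matching : exists2 M, valid M & #|unassigned M| <= N0.
Proof.
have: valid (fun=> None) by split.
move: (fun=> None) => M; move: {2}#|unassigned M| (leqnn #|unassigned M|) => k.
elim: k M => [|k IH] M cU vM; first by exists M => //; lia.
have [|big] := leqP #|unassigned M| N0; first by exists M.
by have [M' vM' lt] := augment_step vM big; apply: (IH M') => //; lia.
Qed.

End Augmentation.

(** * From discrepancy to expansion *)

Section Expansion.
Variables (R : archiRealFieldType) (W : finType) (op : W -> W -> W).
Hypothesis opC : commutative op.
Hypothesis opK : forall x y, op x (op x y) = y.

Lemma sum_indicator (T : finType) (A : {set T}) (P : pred T) :
  \sum_(x in A) (P x)%:R = #|[set x in A | P x]|%:R :> R.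
Proof.
rewrite -sum1_card natr_sum [RHS](eq_bigl (fun x => (x \in A) && P x)) => [|x].
  by rewrite big_mkcondr; apply: eq_bigr => x _; case: (P x).
by rewrite inE.
Qed.

(** Substitute [x = op y z], an involution for fixed [z]. *)
Lemma exchange_op (X Y : {set W}) z :
  \sum_(y in Y) (op y z \in X)%:R = \sum_(x in X) (op x z \in Y)%:R :> R.
Proof.
rewrite (big_mkcond (mem Y)) (big_mkcond (mem X)) /=.
rewrite [RHS](reindex_inj (can_inj (opK z))) /=; apply: eq_bigr => y _.
by rewrite [op (op _ _) _]opC opK [op y z]opC; do 2 case: (_ \in _).
Qed.

(** Take both sets to be everything: each row of [op] is a permutation and meets [C] exactly [#|C|]
    times. *)
Lemma card_of_discrepancy (C : {set W}) beta eps :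
  discrepancy_le op C beta eps ->
  (beta - eps) * #|W|%:R <= #|C|%:R :> R.
Proof.
move=> /(_ setT setT); rewrite cardsT.
have -> : \sum_(a in [set: W]) \sum_(b in [set: W]) (op a b \in C)%:R = #|W|%:R * #|C|%:R :> R.
  under eq_bigr => a _.
    under eq_bigr => b _ do rewrite opC.
    rewrite exchange_op.
    under eq_bigr => b _ do rewrite inE.
    rewrite sumr_const; over.
  by rewrite sumr_const cardsT mulr_natl.
rewrite ler_norml => /andP[h _].
have [->|m0] := eqVneq #|W| 0%N; first by rewrite mulr0 ler0n.
have {}m0 : 0 < #|W|%:R :> R by rewrite ltr0n lt0n.
by rewrite -(ler_pM2l m0); move: h; rewrite expr2; lra.
Qed.

(** Count triples with [p \in P], [y \in A], [z = op p y \in Z]. There are about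
    [beta * #|P| * #|A|] by the discrepancy of [Z]. A point [z] that is not heavy lies in at most
    [T] of them, and the heavy ones lie in about [beta * #|P| * #|H|] at most, by the discrepancy of
    [Y]. *)
Lemma discrepancy_expansion (Y Z P A : {set W}) beta eps T :
  discrepancy_le op Y beta eps -> discrepancy_le op Z beta eps -> A \subset Y ->
  beta * #|P|%:R * (#|A|%:R - #|heavy op Z T P A|%:R) <=
  2 * eps * #|W|%:R ^+ 2 + T%:R * #|W|%:R :> R.
Proof.
move=> dY dZ AY; set H := heavy _ _ _ _ _; set m : R := #|W|%:R.
have := dZ P A; rewrite ler_norml => /andP[h1 _].
have := dY P H; rewrite ler_norml => /andP[_ h2].
suff : \sum_(p in P) \sum_(y in A) (op p y \in Z)%:R <=
    \sum_(p in P) \sum_(z in H) (op p z \in Y)%:R + T%:R * m :> R.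
  by rewrite -/m in h1 h2; move: h1 h2; lra.
have -> : \sum_(p in P) \sum_(y in A) (op p y \in Z)%:R =
    \sum_(z in Z) \sum_(y in A) (op y z \in P)%:R :> R.
  rewrite exchange_big [RHS]exchange_big; apply: eq_bigr => y _ /=.
  by rewrite exchange_op; apply: eq_bigr => z _; rewrite opC.
rewrite (bigID (mem H)) /= lerD //.
  rewrite [leRHS]exchange_big /=.
  rewrite (eq_bigl (mem H)) => [|z]; last first.
    by rewrite /= !inE; case: (z \in Z).
  apply: ler_sum => z _; rewrite -(exchange_op P Y).
  by rewrite [leRHS](big_setID A) /= (setIidPr AY) lerDl sumr_ge0 //.
apply: (@le_trans _ _ (\sum_(z in Z | z \notin H) T%:R)).
  apply: ler_sum => z /andP[zZ]; rewrite inE zZ /= -leqNgt => zT.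
  by rewrite sum_indicator ler_nat.
rewrite sumr_const -[leLHS]mulr_natr ler_wpM2l ?ler0n // ler_nat max_card //.
Qed.

Lemma near_matching_of_discrepancy (E : finType) (C : {set E}) (tgt : E -> option W)
    (Y Z : {set W}) (delta eta eps : R) (T : nat) :
  (forall e e' p, e \in C -> e' \in C ->
     tgt e = Some p -> tgt e' = Some p -> e = e') ->
  0 < delta -> 0 < eta -> 16 * eps <= delta ^+ 2 * eta -> 2 * eps <= delta ->
  8 <= delta * T%:R -> T%:R <= eps * #|W|%:R -> 16 <= delta * #|W|%:R ->
  discrepancy_le op Y (#|C|%:R / #|W|%:R + delta) eps ->
  discrepancy_le op Z (#|C|%:R / #|W|%:R + delta) eps ->
  exists2 M, valid op C tgt Y Z M & #|unassigned C M|%:R <= eta * #|W|%:R.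
Proof.
set m : R := #|W|%:R => tgt_inj d0 e0 eps1 eps2 dT Tm dm dY dZ.
have m0 : 0 < m by nra.
have N0P : 0 <= eta * m by nra.
(* The label classes exceed [#|C|] by about [delta * m]: half of it covers the error [eps * m], the
   other half is the surplus [s], and the expansion defect [t] is half of [s] up to rounding. *)
pose N0 := Num.truncn (eta * m).
pose s := Num.truncn (delta * m / 2).
pose t := Num.truncn (delta * m / 4).
have s1 : s%:R <= delta * m / 2 by rewrite truncn_le //; lra.
have s2 : delta * m / 2 < s%:R + 1 by rewrite natr1 truncnS_gt.
have t1 : t%:R <= delta * m / 4 by rewrite truncn_le //; lra.
have t2 : delta * m / 4 < t%:R + 1 by rewrite natr1 truncnS_gt.
have ts : (t < s)%N by rewrite -(ltr_nat R); lra.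
have size_of X : discrepancy_le op X (#|C|%:R / m + delta) eps -> (#|C| + s <= #|X|)%N.
  move=> /card_of_discrepancy; rewrite -/m -(ler_nat R) natrD => h.
  have : (#|C|%:R / m + delta - eps) * m = #|C|%:R + delta * m - eps * m.
    by field; rewrite gt_eqF.
  nra.
have [||M vM cM] := @near_matching W E op opC opK C tgt Y Z N0 T s t tgt_inj ts
    (size_of _ dY) (size_of _ dZ).
- apply: (@leq_ltn_trans #|W|); first exact: max_card.
  rewrite -(ltr_nat R) -/m natrD natrM natrB ?(ltnW ts) //.
  have T0 : 0 <= T%:R :> R by exact: ler0n.
  (* The rounding loss in [s - t] is below 1, hence absorbed by halving [delta * m / 4]; then
     [8 <= delta * T] makes [T] rounds exhaust [m] points. *)
  have : delta * m / 8 * T%:R <= T%:R * (s%:R - t%:R) by rewrite mulrC ler_wpM2l //; lra.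
  nra.
(* A defect above [t] would make the left side of [discrepancy_expansion] at least
   [delta ^ 2 * eta * m ^ 2 / 4], hence at least [4 * eps * m ^ 2], against an upper bound of
   [3 * eps * m ^ 2]. *)
- move=> P A cP AY; rewrite leqNgt; apply/negP => lt.
  have := discrepancy_expansion P T dY dZ AY; rewrite -/m.
  set H := heavy _ _ _ _ _ in lt *.
  have P1 : eta * m <= #|P|%:R.
    by apply: ltW; apply: lt_le_trans (truncnS_gt _) _; rewrite ler_nat.
  have AH : delta * m / 4 <= #|A|%:R - #|H|%:R.
    have : #|H|%:R + t%:R + 1 <= #|A|%:R :> R by rewrite -natrD natr1 ler_nat.
    by lra.
  have b1 : delta <= #|C|%:R / m + delta by rewrite lerDr divr_ge0 ?ler0n // ltW.
  have bP : delta * (eta * m) <= (#|C|%:R / m + delta) * #|P|%:R.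
    by apply: ler_pM => //; apply: ltW.
  have bPA : delta * (eta * m) * (delta * m / 4) <=
     (#|C|%:R / m + delta) * #|P|%:R * (#|A|%:R - #|H|%:R).
    by apply: ler_pM => //; nra.
  have mm : 0 < m * m by nra.
  have h1 : 16 * eps * (m * m) <= delta ^+ 2 * eta * (m * m) by rewrite ler_pM2r.
  move: bPA; set X := (_ * #|P|%:R * _).
  have h2 : T%:R * m <= eps * m * m by rewrite ler_pM2r.
  have : 0 < eps by rewrite -(pmulr_lgt0 _ m0); apply: lt_le_trans Tm; rewrite -(pmulr_rgt0 _ d0); lra.
  nra.
exists M => //; apply: le_trans (_ : N0%:R <= _); first by rewrite ler_nat.
by rewrite truncn_le.
Qed.

End Expansion.

(** * Steiner operation and rooted trees *)

Lemma steiner_operation (W : finType) (S : {set {set W}}) :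
  steiner_triple_system S ->
  exists op : W -> W -> W,
  [/\ commutative op, forall x, op x x = x, forall x y, op x (op x y) = y &
      forall x y, x != y -> [set x; y; op x y] \in S].
Proof.
move=> [S3 SP].
pose rel3 x y z := [&& x != y, z != x, z != y & [set x; y; z] \in S].
have rel_ex x y : x != y -> exists z, rel3 x y z.
  move=> xy; have [e [[eS xe ye] _]] := SP x y xy.
  have := S3 e eS; rewrite (cardsD1 x) xe (cardsD1 y) !inE eq_sym xy ye /=.
  move=> [] /eqP /cards1P[z ez]; exists z.
  have : z \in e :\ x :\ y by rewrite ez set11.
  rewrite !inE => /and3P[zy zx ze]; rewrite /rel3 xy zx zy /=.
  suff -> : [set x; y; z] = e by [].
  apply/setP => v; have /setP /(_ v) := ez; rewrite !inE.
  have [->|vx] := eqVneq v x; first by rewrite xe.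
  by have [->|vy] := eqVneq v y; [rewrite ye|move=> /= ->].
have rel_uniq x y z z' : rel3 x y z -> rel3 x y z' -> z = z'.
  move=> /and4P[xy zx zy zS] /and4P[_ z'x z'y z'S].
  have [e [_ eU]] := SP x y xy.
  have e1 : e = [set x; y; z] by apply: eU; rewrite !inE !eqxx !orbT.
  have e2 : e = [set x; y; z'] by apply: eU; rewrite !inE !eqxx !orbT.
  have : z \in [set x; y; z'] by rewrite -e2 e1 !inE eqxx !orbT.
  by rewrite !inE (negbTE zx) (negbTE zy) => /eqP.
(* The default is reached only for [x = y], where it makes [op] idempotent. *)
pose op x y := odflt x [pick z | rel3 x y z].
have opP x y : x != y -> rel3 x y (op x y).
  move=> /rel_ex[z zP]; rewrite /op; case: pickP => [//|/(_ z)].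
  by rewrite zP.
have opxx x : op x x = x.
  by rewrite /op; case: pickP => // z; rewrite /rel3 eqxx.
have op_eq x y z : rel3 x y z -> op x y = z.
  by move=> h; case/and4P: (h) => xy _ _ _; apply: rel_uniq (opP _ _ xy) h.
exists op; split=> //.
- move=> x y; have [->//|xy] := eqVneq x y; apply: op_eq.
  have /and4P[_ h1 h2 h3] : rel3 y x (op y x) by rewrite opP // eq_sym.
  by rewrite /rel3 xy h1 h2 /= [[set x; y]]setUC.
- move=> x y; have [->|xy] := eqVneq x y; first by rewrite !opxx.
  apply: op_eq; have /and4P[_ h1 h2 h3] := opP _ _ xy.
  apply/and4P; split; rewrite 1?eq_sym //.
  by rewrite -setUA [[set op x y; y]]setUC setUA.
- by move=> x y /opP /and4P[].
Qed.

(** A parent structure graded by depth: [bot e] determines [e], several edges may share a top, and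
    [mid e] is the private vertex. *)
Record rooted (V : finType) (T : {set {set V}}) (r : V)
    (top bot mid : {set V} -> V) (dep : V -> nat) : Prop := Rooted {
  rooted_edge : forall e, e \in T -> e = [set top e; bot e; mid e];
  rooted_top_bot : forall e, e \in T -> top e != bot e;
  rooted_bot_inj : forall e e', e \in T -> e' \in T -> bot e = bot e' -> e = e';
  rooted_mid_inj : forall e e', e \in T -> e' \in T -> mid e = mid e' -> e = e';
  rooted_bot_mid : forall e e', e \in T -> e' \in T -> bot e != mid e';
  rooted_top_mid : forall e e', e \in T -> e' \in T -> top e != mid e';
  rooted_dep : forall e, e \in T -> dep (bot e) = (dep (top e)).+1;
  rooted_cover : forall v, v = r \/ exists2 e, e \in T & v = bot e \/ v = mid e }.

(** * Rooting a subdivision tree *)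

Section SubdivisionTree.
Variables (V : finType) (T : {set {set V}}).
Implicit Type p : seq ({set V} * V).

Lemma hwalk_cat x p1 p2 :
  hwalk T x (p1 ++ p2) = hwalk T x p1 && hwalk T (last x (unzip2 p1)) p2.
Proof.
elim: p1 x => [|[e v] p1 IH] x //=.
by rewrite IH !andbA.
Qed.

Lemma degree1_uniq v e e' :
  hdegree T v = 1%N -> e \in T -> e' \in T -> v \in e -> v \in e' -> e = e'.
Proof.
move=> /eqP /cards1P[e0 /setP h] eT e'T ve ve'.
have := h e; have := h e'; rewrite !inE eT e'T ve ve' /=.
by move=> /esym /eqP -> /esym /eqP ->.
Qed.

Lemma split_walk x y p : y \in x :: unzip2 p ->
  exists p1 p2, p = p1 ++ p2 /\ last x (unzip2 p1) = y.
Proof.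
elim: p x => [|[e v] p IH] x; first by rewrite inE => /eqP ->; exists [::], [::].
rewrite inE => /orP[/eqP ->|]; first by exists [::], ((e, v) :: p).
by move=> /IH[p1 [p2 [-> h]]]; exists ((e, v) :: p1), p2.
Qed.

Lemma split_edge e p : e \in unzip1 p -> exists p1 p2 w, p = p1 ++ (e, w) :: p2.
Proof.
elim: p => [|[e' v] p IH] //=.
rewrite inE => /orP[/eqP ->|]; first by exists [::], p, v.
by move=> /IH[p1 [p2 [w ->]]]; exists ((e', v) :: p1), p2, w.
Qed.

Lemma split_last p : p = [::] \/ exists p' e v, p = rcons p' (e, v).
Proof. by case/lastP: p => [|p' [e v]]; [left|right; exists p', e, v]. Qed.

Hypothesis tree : subdivision_tree T.

Let T3 : uniform3 T. Proof. by case: tree => -[]. Qed.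
Let path_uniq x y p q : hpath T x y p -> hpath T x y q -> p = q.
Proof.
by move=> hp hq; case: tree => -[_ _ /(_ x y)[p0 [_ h]]] _; rewrite -(h _ hp) (h _ hq).
Qed.

(** If the path to [x] avoids [e], it avoids [y] too, since its tail from [y] and the single edge
    [e] would be two paths. If it uses [e], it neither enters nor leaves [e] at [mid], which lies on
    no other edge; as [x] comes last, it runs from [y] to [x] and stops. *)
Lemma hpath_edge e x y r (mid : V) px :
  e \in T -> x \in e -> y \in e -> mid \in e -> hdegree T mid = 1%N ->
  x != y -> x != mid -> y != mid -> r != mid ->
  hpath T r x px ->
  hpath T r y (rcons px (e, y)) \/ exists2 py, px = rcons py (e, x) & hpath T r y py.
Proof.
move=> eT xe ye me dm xy xm ym rm hpx; have [wk lst uv ue] := hpx.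
have e3 v : v \in e -> [|| v == x, v == y | v == mid].
  move=> ve; have : [set x; y; mid] == e.
    rewrite eqEcard; apply/andP; split.
      by apply/subsetP => z; rewrite !inE => /orP[/orP[]|] /eqP ->.
    by rewrite T3 // -setUA cardsU1 cards2 !inE negb_or xy xm ym.
  by move=> /eqP he; move: ve; rewrite -he !inE orbA.
have [epx|epx] := boolP (e \in unzip1 px); last first.
  left.
  have [ypx|ypx] := boolP (y \in r :: unzip2 px).
    have [p1 [p2 [pE ly]]] := split_walk ypx.
    have p2E : p2 = [:: (e, x)].
      apply: (@path_uniq y x).
        move: wk lst uv ue; rewrite pE hwalk_cat ly => /andP[_ w2].
        rewrite /unzip2 /unzip1 !map_cat last_cat -/unzip2 -/(unzip2 p1) ly => l2.
        rewrite -cat_cons cat_uniq => /and3P[_ /hasPn dis u2].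
        rewrite cat_uniq => /and3P[_ _ u2']; split=> //=.
        apply/andP; split; last by [].
        apply/negP => /dis /negP; apply.
        by rewrite -ly; apply: mem_last.
      by split=> //=; rewrite ?eT ?ye ?xe // inE eq_sym xy.
    by move: epx; rewrite pE p2E /unzip1 map_cat mem_cat /= mem_head orbT.
  split.
  - by rewrite -cats1 hwalk_cat wk lst /= eT xe ye.
  - by rewrite /unzip2 map_rcons last_rcons.
  - by rewrite /unzip2 map_rcons -rcons_cons rcons_uniq ypx uv.
  - by rewrite /unzip1 map_rcons rcons_uniq epx ue.
right; have [p1 [p2 [v pE]]] := split_edge epx.
move: wk lst uv ue; rewrite pE hwalk_cat; set u := last r _ => /andP[w1 /=].
move=> /and4P[_ u_e v_e w2]; rewrite /unzip2 /unzip1 !map_cat /= last_cat /=.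
rewrite -/unzip2 -/(unzip2 p1) -/(unzip2 p2) -/(unzip1 p1) -/(unzip1 p2).
move=> lst uv ue.
have ue1 : e \notin unzip1 p1.
  by move: ue; rewrite cat_uniq => /and3P[_ /hasPn /(_ e (mem_head _ _))].
have ue2 : e \notin unzip1 p2.
  by move: ue; rewrite cat_uniq => /and3P[_ _ /andP[]].
have um : u != mid.
  apply/eqP => um; have [p0|[p' [e' [v' p1E]]]] := split_last p1.
    by move: rm; rewrite -um /u p0 eqxx.
  move: w1; rewrite p1E -cats1 hwalk_cat /= => /and5P[_ e'T _ v'e' _].
  have v'm : v' = mid by rewrite -um /u p1E /unzip2 map_rcons last_rcons.
  have ee' : e' = e by apply: (degree1_uniq dm) => //; rewrite -v'm.
  by move: ue1; rewrite p1E ee' /unzip1 map_rcons mem_rcons mem_head.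
have vm : v != mid.
  apply/eqP => vm; case: p2 pE lst w2 uv ue ue2 => [|[e' v'] p2] pE lst w2 uv ue ue2.
    by move: xm; rewrite -vm -lst eqxx.
  move: w2 => /= /and4P[e'T ve' _ _].
  have ee' : e' = e by apply: (degree1_uniq dm) => //; rewrite -vm.
  by move: ue2; rewrite ee' /= mem_head.
have {uv} : uniq ((r :: unzip2 p1) ++ v :: unzip2 p2) by [].
rewrite cat_uniq => /and3P[uv1 /hasPn dis uv2].
have dis' z : z \in r :: unzip2 p1 -> z \in v :: unzip2 p2 -> False.
  by move=> z1 z2; move: (dis _ z2); rewrite z1.
have uin : u \in r :: unzip2 p1 by rewrite /u mem_last.
have uv : u != v by apply/eqP => h; apply: (dis' u); rewrite // h mem_head.
have xin : x \in v :: unzip2 p2 by rewrite -lst mem_last.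
have ux : u != x by apply/eqP => h; apply: (dis' u); rewrite // h.
have uy : u = y by have := e3 u u_e; rewrite (negbTE um) (negbTE ux) orbF => /eqP.
have vx : v = x.
  have := e3 v v_e; rewrite (negbTE vm) -uy eq_sym [v == u]eq_sym (negbTE uv) !orbF.
  by move=> /eqP.
have p20 : p2 = [::].
  case: p2 pE lst uv2 {w2 ue ue2 dis dis' xin} => [//|[e' v'] p2] pE /= lst /andP[vn _].
  by move: vn; rewrite vx -lst mem_last.
exists p1; first by rewrite p20 vx cats1.
split=> //.
by move: ue; rewrite cat_uniq => /and3P[].
Qed.

(** A boolean form of [hpath], so that paths can be selected by [xchoose]. *)
Let hpathb x y p := [&& hwalk T x p, last x (unzip2 p) == y,
  uniq (x :: unzip2 p) & uniq (unzip1 p)].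

Let hpathP x y p : reflect (hpath T x y p) (hpathb x y p).
Proof.
by apply: (iffP and4P) => -[h1 h2 h3 h4]; split=> //; apply/eqP.
Qed.

(** Root paths orient the edges: by [hpath_edge] the path to one end of [e] is the path to the other
    end followed by [e]. Depth is path length. *)
Lemma subdivision_tree_rooted (e0 : {set V}) : e0 \in T ->
  exists r top bot mid dep, rooted T r top bot mid dep.
Proof.
move=> e0T.
have /card_gt0P[r0 _] : (0 < #|e0|)%N by rewrite T3.
pose mid (e : {set V}) := odflt r0 [pick v in e | hdegree T v == 1%N].
have midP e : e \in T -> mid e \in e /\ hdegree T (mid e) = 1%N.
  move=> eT; rewrite /mid; case: pickP => [v /andP[ve /eqP]//|nv].
  have [v ve dv] : exists2 v, v \in e & hdegree T v = 1%N by case: tree => _; apply.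
  by move: (nv v); rewrite ve dv eqxx.
have mid_uniq e e' : e \in T -> e' \in T -> mid e \in e' -> e = e'.
  by move=> eT e'T; have [me dm] := midP e eT; apply: degree1_uniq.
(* Such a root is no private vertex at all: [r = mid e] would put [mid e] in [e0] and force
   [e = e0]. *)
have /card_gt0P[r] : (0 < #|e0 :\ mid e0|)%N.
  by have := T3 e0T; rewrite (cardsD1 (mid e0)); case: (_ \in _) => /=; lia.
rewrite !inE => /andP[rm re0].
have r_mid e : e \in T -> r != mid e.
  move=> eT; apply: contra_neq rm => h; rewrite h; congr mid.
  by apply: mid_uniq => //; rewrite -h.
have exP v : exists p, hpathb r v p.
  by case: tree => -[_ _ /(_ r v)[p [/hpathP ? _]]] _; exists p.
pose P v := xchoose (exP v).
have PP v : hpath T r v (P v) by apply/hpathP; apply: xchooseP.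
pose spec e (tb : V * V) := [&& tb.1 != tb.2, e == [set tb.1; tb.2; mid e] &
   P tb.2 == rcons (P tb.1) (e, tb.2)].
pose tb e := odflt (r, r) [pick x | spec e x].
have specP e : e \in T -> spec e (tb e).
  move=> eT; rewrite /tb; case: pickP => [//|ns]; exfalso.
  have [me dm] := midP e eT.
  have := T3 eT; rewrite (cardsD1 (mid e)) me => -[] /eqP /cards2P[x [y [xy exy]]].
  have : x \in e :\ mid e by rewrite exy !inE eqxx.
  have : y \in e :\ mid e by rewrite exy !inE eqxx orbT.
  rewrite !inE => /andP[ym ye] /andP[xm xe].
  have eE : e = [set x; y; mid e] by rewrite -exy setUC setD1K.
  have [h|[py px h]] := hpath_edge eT xe ye me dm xy xm ym (r_mid e eT) (PP x).
    by have := ns (x, y); rewrite /spec /= xy -eE (path_uniq (PP y) h) !eqxx.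
  have := ns (y, x); rewrite /spec /= eq_sym xy px (path_uniq (PP y) h) eqxx andbT.
  by rewrite [[set y; x]]setUC -eE eqxx.
pose top e := (tb e).1; pose bot e := (tb e).2.
have tbne e : e \in T -> top e != bot e by move=> /specP /and3P[].
have eE e : e \in T -> e = [set top e; bot e; mid e].
  by move=> /specP /and3P[_ /eqP].
have PE e : e \in T -> P (bot e) = rcons (P (top e)) (e, bot e).
  by move=> /specP /and3P[_ _ /eqP].
have bot_in e : e \in T -> bot e \in e.
  by move=> eT; rewrite {2}(eE _ eT) !inE eqxx orbT.
have top_in e : e \in T -> top e \in e.
  by move=> eT; rewrite {2}(eE _ eT) !inE eqxx.
have cE e : e \in T -> (#|[set top e; bot e; mid e]| = 3)%N by move=> eT; rewrite -eE ?T3.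
have bm e : e \in T -> bot e != mid e.
  move=> eT; apply/eqP => h; have := cE e eT.
  by rewrite h -setUA setUid cards2; case: (_ == _).
have tm e : e \in T -> top e != mid e.
  move=> eT; apply/eqP => h; have := cE e eT.
  by rewrite h setUAC setUid cards2; case: (_ == _).
exists r, top, bot, mid, (fun v => size (P v)); split=> //.
- move=> e e' eT e'T h; have := PE e' e'T; rewrite -h (PE e eT) h.
  by move=> /rcons_inj[].
- move=> e e' eT e'T h; apply: mid_uniq => //; rewrite h.
  by case: (midP e' e'T).
- move=> e e' eT e'T; apply/eqP => h.
  have ee : e' = e by apply: mid_uniq => //; rewrite -h bot_in.
  by move: (bm e eT); rewrite {1}h ee eqxx.
- move=> e e' eT e'T; apply/eqP => h.
  have ee : e' = e by apply: mid_uniq => //; rewrite -h top_in.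
  by move: (tm e eT); rewrite {1}h ee eqxx.
- by move=> e eT /=; rewrite (PE e eT) size_rcons.
move=> v; have [P0|[p [e [v' pE]]]] := split_last (P v).
  by left; have [_ + _ _] := PP v; rewrite P0.
right; have [wk lst uv ue] := PP v.
move: wk lst ue; rewrite pE -cats1 hwalk_cat /= => /and5P[_ eT _ v'e _].
rewrite cats1 /unzip2 /unzip1 !map_rcons last_rcons /= => v'v.
rewrite -/(unzip1 p) => ue; exists e => //; move: v'e; rewrite v'v {1}(eE e eT) !inE.
rewrite -orbA => /or3P[/eqP vt|/eqP ->|/eqP ->]; [|by left|by right].
(* The last edge [e] of the path to [v] cannot have [v] on top, for then the path to [bot e] would
   use [e] twice. *)
exfalso; have [_ _ _ +] := PP (bot e); rewrite (PE e eT) -vt pE /unzip1 !map_rcons.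
by rewrite rcons_uniq mem_rcons mem_head.
Qed.

End SubdivisionTree.

(** * Embedding level by level *)

Section LevelEmbedding.
Local Open Scope nat_scope.
Variables (W V : finType) (op : W -> W -> W) (T : {set {set V}}).
Variables (r : V) (top bot mid : {set V} -> V) (dep : V -> nat).
Hypothesis T_rooted : rooted T r top bot mid dep.
Variables (L d : nat) (lev : {set V} -> 'I_L) (idx : {set V} -> 'I_d).
Hypothesis idx_inj : forall e e', e \in T -> e' \in T ->
  top e = top e' -> idx e = idx e' -> e = e'.
Hypothesis lev_parent : forall e e', e \in T -> e' \in T -> bot e' = top e ->
  0 < lev e -> lev e = (lev e').+1 :> nat.
Variables (f : W -> option ('I_L * 'I_d * bool)) (N0 : nat).

Definition edge_class (i : 'I_L * 'I_d) : {set {set V}} :=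
  [set e in T | (lev e, idx e) == i].
Definition label_class x : {set W} := [set y | f y == Some x].

Hypothesis class_matching : forall i (tgt : {set V} -> option W),
  (forall e e' p, e \in edge_class i -> e' \in edge_class i ->
     tgt e = Some p -> tgt e' = Some p -> e = e') ->
  exists M, valid op (edge_class i) tgt (label_class (i, false))
              (label_class (i, true)) M /\
            #|unassigned (edge_class i) M| <= N0.

(* [G e] is the position of [bot e], if it has been embedded. *)
Definition level_state (j : nat) (G : {set V} -> option W) : Prop :=
  [/\ forall e a, G e = Some a -> [/\ e \in T, 0 < lev e & lev e <= j],
      forall e a, G e = Some a -> f a = Some (lev e, idx e, false),
      forall e e' a a', G e = Some a -> G e' = Some a' -> bot e' = top e ->
        f (op a' a) = Some (lev e, idx e, true) &
  [/\ forall e e' a, G e = Some a -> G e' = Some a -> e = e',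
      forall e1 e1' a1 a1' e2 e2' a2 a2',
        G e1 = Some a1 -> G e1' = Some a1' -> bot e1' = top e1 ->
        G e2 = Some a2 -> G e2' = Some a2' -> bot e2' = top e2 ->
        op a1' a1 = op a2' a2 -> e1 = e2 &
      #|[set e in T | (0 < lev e <= j) && (G e == None)]| <= j * (d * N0)]].

(** Each child index gives one matching problem, in which tops are distinct. Different problems use
    different labels, so their solutions are disjoint, and each of the [d] problems leaves at most
    [N0] edges. *)
Lemma level_step j G : j.+1 < L -> level_state j G -> exists G', level_state j.+1 G'.
Proof.
move=> jL [J0 J1 J2 [J3 J4 J5]].
pose par e := [pick e' in T | bot e' == top e].
have parE e e' : e' \in T -> bot e' = top e -> par e = Some e'.
  move=> e'T bt; rewrite /par; case: pickP => [e2 /andP[e2T /eqP b2]|/(_ e')].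
    by congr Some; apply: (rooted_bot_inj T_rooted); rewrite // bt.
  by rewrite e'T bt eqxx.
(* A target is missing if the parent edge was not embedded; this holds for all edges of level one,
   as [G] is empty on level 0. It is how the tree is cut. *)
pose tgt e := obind G (par e).
have tgtP e p : tgt e = Some p -> exists2 e', G e' = Some p & bot e' = top e.
  rewrite /tgt /par; case: pickP => [e' /andP[_ /eqP bt] /= Ge'|//].
  by exists e'.
pose o := Ordinal jL.
have Mex (c : 'I_d) : exists M, valid op (edge_class (o, c)) tgt
      (label_class (o, c, false)) (label_class (o, c, true)) M /\
      #|unassigned (edge_class (o, c)) M| <= N0.
  apply: class_matching => e e' p; rewrite !inE => /andP[eT /eqP[_ ie]].
  move=> /andP[e'T /eqP[_ ie']] /tgtP[e1 G1 b1] /tgtP[e2 G2 b2].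
  by apply: idx_inj => //; rewrite -?b1 -?b2 ?(J3 _ _ _ G1 G2) // ie ie'.
have [M MP] := fin_all_exists Mex.
pose G' e := if lev e == j.+1 :> nat then omap fst (M (idx e) e) else G e.
have G'new e a : lev e = j.+1 :> nat -> G' e = Some a -> exists b,
   [/\ M (idx e) e = Some (a, b), e \in T, lev e = o & f b = Some (lev e, idx e, true)].
  move=> le; rewrite /G' le eqxx; case Me: (M (idx e) e) => [[a' b]|] //= [<-].
  have [[M1 _ _ _] _] := MP (idx e); have [h1 _ h2] := M1 _ _ _ Me.
  move: h1 h2; rewrite !inE => /andP[eT /eqP[lo]] /eqP fb.
  by exists b; split=> //; rewrite fb lo.
have G'old e : lev e <> j.+1 :> nat -> G' e = G e.
  by move=> le; rewrite /G'; case: eqP.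
have K0 e a : G' e = Some a -> [/\ e \in T, 0 < lev e & lev e <= j.+1].
  have [le|le] := eqVneq (lev e : nat) j.+1.
    by move=> /(G'new _ _ le)[b [_ eT _ _]]; rewrite le.
  by rewrite G'old; [move=> /J0[? ? ?]; split=> //; lia|apply/eqP].
have K1 e a : G' e = Some a -> f a = Some (lev e, idx e, false).
  have [le|le] := eqVneq (lev e : nat) j.+1.
    move=> /(G'new _ _ le)[b [Me eT lo _]].
    have [[M1 _ _ _] _] := MP (idx e); have [_ h2 _] := M1 _ _ _ Me.
    by move: h2; rewrite inE -lo => /eqP.
  by rewrite G'old; [apply: J1|apply/eqP].
have Kpar e e' a a' : G' e = Some a -> G' e' = Some a' -> bot e' = top e -> G e' = Some a'.
  move=> Ge Ge' bt; rewrite -G'old // => le'.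
  have [eT l0 lj] := K0 _ _ Ge; have [e'T l0' lj'] := K0 _ _ Ge'.
  by have := lev_parent eT e'T bt l0; lia.
have Knew e e' a a' : lev e = j.+1 :> nat ->
    G' e = Some a -> G' e' = Some a' -> bot e' = top e ->
    M (idx e) e = Some (a, op a' a) /\ f (op a' a) = Some (lev e, idx e, true).
  move=> le Ge Ge' bt; have [b [Me eT lo fb]] := G'new _ _ le Ge.
  have te : tgt e = Some a'.
    have e'T : e' \in T by case: (K0 _ _ Ge').
    by rewrite /tgt (parE _ _ e'T bt) /= (Kpar _ _ _ _ Ge Ge' bt).
  have [[_ M2 _ _] _] := MP (idx e).
  by rewrite (M2 _ _ _ _ Me te).
have K2 e e' a a' : G' e = Some a -> G' e' = Some a' -> bot e' = top e ->
        f (op a' a) = Some (lev e, idx e, true).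
  move=> Ge Ge' bt; have [le|le] := eqVneq (lev e : nat) j.+1.
    by case: (Knew _ _ _ _ le Ge Ge' bt).
  by apply: (J2 e e') => //; [rewrite -G'old //; apply/eqP|exact: Kpar Ge Ge' bt].
exists G'; split=> //; split.
- move=> e e' a Ge Ge'; have := K1 _ _ Ge'; rewrite (K1 _ _ Ge) => -[ll ii].
  have [le|le] := eqVneq (lev e : nat) j.+1; last first.
    apply: (J3 e e' a); first by rewrite -G'old //; apply/eqP.
    by rewrite -G'old // -ll; apply/eqP.
  have [b [Me _ _ _]] := G'new _ _ le Ge.
  have [|b' [Me' _ _ _]] := G'new e' a _ Ge'; first by rewrite -ll.
  rewrite -ii in Me'.
  by have [[_ _ M3 _] _] := MP (idx e); apply: M3 Me Me'.
- move=> e1 e1' a1 a1' e2 e2' a2 a2' G1 G1' b1 G2 G2' b2 eq_op.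
  have := K2 _ _ _ _ G2 G2' b2; rewrite -eq_op (K2 _ _ _ _ G1 G1' b1) => -[ll ii].
  have [le|le] := eqVneq (lev e1 : nat) j.+1; last first.
    apply: (J4 e1 e1' a1 a1' e2 e2' a2 a2') => //.
    + by rewrite -G'old //; apply/eqP.
    + exact: Kpar G1 G1' b1.
    + by rewrite -G'old // -ll; apply/eqP.
    + exact: Kpar G2 G2' b2.
  have [h1 _] := Knew _ _ _ _ le G1 G1' b1.
  have [|h2 _] := Knew e2 e2' a2 a2' _ G2 G2' b2; first by rewrite -ll.
  rewrite -ii -eq_op in h2.
  by have [[_ _ _ M4] _] := MP (idx e1); apply: M4 h1 h2.
set X := [set e in T | (0 < lev e <= j) && (G e == None)] in J5.
apply: (@leq_trans #|X :|: \bigcup_(c in [set: 'I_d]) unassigned (edge_class (o, c)) (M c)|).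
  apply: subset_leq_card; apply/subsetP => e; rewrite !inE.
  move=> /and3P[eT /andP[l0 lj] Ge]; rewrite eT l0 /=.
  have [le|le] := eqVneq (lev e : nat) j.+1; last first.
    by apply/orP; left; rewrite -G'old ?Ge ?andbT; [lia|apply/eqP].
  apply/orP; right; apply/bigcupP; exists (idx e); first by rewrite inE.
  rewrite !inE eT /=.
  apply/andP; split; first by apply/eqP; congr pair; apply: val_inj.
  by move: Ge; rewrite /G' le eqxx; case: (M _ _).
apply: leq_trans (leq_card_setU _ _) _; rewrite mulSn addnC leq_add //.
rewrite (leq_trans (card_bigcup_le (k := N0) _)) ?cardsT ?card_ord // => c _.
by case: (MP c).
Qed.

Lemma level_embedding : 0 < L -> exists G, level_state L.-1 G.
Proof.
move=> L0; suff H j : j < L -> exists G, level_state j G by apply: H; rewrite prednK.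
elim: j => [|j IH] jL.
  exists (fun=> None); split=> //; split=> //.
  rewrite mul0n leqn0 cards_eq0; apply/eqP/setP => e; rewrite !inE.
  by case: (lev e : nat) => [|n]; rewrite ?ltnn ?ltn0 ?andbF.
by have [G] := IH (ltnW jL); apply: level_step.
Qed.

End LevelEmbedding.

(** * Greedy completion *)

Section GreedyCompletion.
Local Open Scope nat_scope.
Variables (W V : finType) (op : W -> W -> W) (T : {set {set V}}).
Hypothesis opC : commutative op.
Hypothesis opxx : forall x, op x x = x.
Hypothesis opK : forall x y, op x (op x y) = y.
Variables (r : V) (top bot mid : {set V} -> V) (dep : V -> nat).
Hypothesis T_rooted : rooted T r top bot mid dep.

(** The vertices of the underlying graph tree. *)
Definition core : {set V} := [set v | [forall e in T, v != mid e]].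
Definition active (D : {set V}) : {set {set V}} :=
  [set e in T | (top e \in D) && (bot e \in D)].
Definition third (g : V -> W) e := op (g (top e)) (g (bot e)).
Definition used (D : {set V}) (g : V -> W) : {set W} := (g @: D) :|: (third g @: active D).

Definition partial_embedding (D : {set V}) (g : V -> W) : Prop :=
  [/\ {in D &, injective g}, {in active D &, injective (third g)} &
      forall e v, e \in active D -> v \in D -> third g e <> g v].

Lemma embedding_of_partial (S : {set {set W}}) g :
  (forall x y, x != y -> [set x; y; op x y] \in S) ->
  partial_embedding core g -> subhypergraph T S.
Proof.
move=> opS [g1 g2 g3].
have coreT e : e \in T -> e \in active core.
  move=> eT; rewrite !inE eT /=; apply/andP; split; apply/forall_inP => e' e'T.
    exact: (rooted_top_mid T_rooted).
  exact: (rooted_bot_mid T_rooted).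
pose F v := if [pick e in T | mid e == v] is Some e then third g e else g v.
have F_mid e : e \in T -> F (mid e) = third g e.
  move=> eT; rewrite /F; case: pickP => [e' /andP[e'T /eqP h]|/(_ e)].
    by rewrite (rooted_mid_inj T_rooted e'T eT h).
  by rewrite eT eqxx.
have F_core v : v \in core -> F v = g v.
  rewrite inE => /forall_inP vm; rewrite /F; case: pickP => [e /andP[eT /eqP h]|//].
  by move: (vm e eT); rewrite h eqxx.
have F_case v : v \in core \/ exists2 e, e \in T & v = mid e.
  have [|] := boolP (v \in core); first by left.
  by rewrite inE => /forall_inPn[e eT /negPn/eqP ->]; right; exists e.
exists F.
  move=> v v'; case: (F_case v) => [vc|[e eT ->]]; case: (F_case v') => [vc'|[e' eT' ->]].
  - by rewrite !F_core //; apply: g1.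
  - by rewrite F_core // F_mid // => /esym /g3 []; rewrite ?coreT.
  - by rewrite (F_core v') // F_mid // => /g3 []; rewrite ?coreT.
  - by rewrite !F_mid // => /g2 -> //; rewrite ?coreT.
move=> e eT; rewrite (rooted_edge T_rooted eT) !imsetU !imset_set1.
have := coreT e eT; rewrite inE eT /= => /andP[tc bc].
rewrite F_mid // !F_core //; apply: opS.
by apply: contra_neq (rooted_top_bot T_rooted eT) => /g1; apply.
Qed.

Variables (d : nat) (Q : {set W}) (N : nat).
Hypothesis degT : forall v, hdegree T v <= d.
Hypothesis Q_rich : forall l : seq W, size l <= d ->
  N < #|[set q in Q | all (fun u => op q u \in Q) l]|.

(** The image [q] of [x] and the at most [d] third points it creates are all sought in [Q], so only
    the used points inside [Q] can collide with them, and their number grows by at most [d.+1]. *)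
Lemma greedy_step D g x : partial_embedding D g -> x \notin D ->
  #|used D g :&: Q| * d.+1 <= N ->
  exists g', partial_embedding (x |: D) g' /\
    #|used (x |: D) g' :&: Q| <= #|used D g :&: Q| + d.+1.
Proof.
move=> [g1 g2 g3] xD; set B := used D g :&: Q => BN.
pose oth e := if top e == x then bot e else top e.
pose Ex := [set e in T | (x \in [set top e; bot e]) && (oth e \in D)].
pose l := [seq g (oth e) | e <- enum Ex].
have sl : size l <= d.
  rewrite size_map -cardE; apply: leq_trans (degT x); apply: subset_leq_card.
  apply/subsetP => e; rewrite !inE => /and3P[eT xe _]; rewrite eT.
  by rewrite (rooted_edge T_rooted eT) !inE xe.
have lP e : e \in Ex -> g (oth e) \in l.
  by move=> eE; apply/mapP; exists e => //; rewrite mem_enum.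
(* The equation [op q u = b] means [q = op b u]. *)
pose bad := B :|: \bigcup_(b in B) [set op b u | u in l].
have cbad : #|bad| <= #|B| * d.+1.
  apply: leq_trans (leq_card_setU _ _) _; rewrite mulnS leq_add2l.
  apply: card_bigcup_le => b _; apply: leq_trans (leq_imset_card _ _) _.
  by apply: leq_trans (card_size _) sl.
have : ~~ ([set q in Q | all (fun u => op q u \in Q) l] \subset bad).
  apply/negP => /subset_leq_card; rewrite leqNgt => /negP; apply.
  by apply: leq_ltn_trans cbad _; apply: leq_ltn_trans BN (Q_rich sl).
case/subsetPn => q; rewrite inE => /andP[qQ /allP qlQ]; rewrite !inE negb_or.
rewrite qQ andbT => /andP[qU qbad].
have {}qU : q \notin used D g by rewrite inE.
have quU u : u \in l -> op q u \notin used D g.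
  move=> ul; apply: contra qbad => h; apply/bigcupP; exists (op q u).
    by rewrite inE h qlQ.
  by apply/imsetP; exists u => //; rewrite [op (op _ _) _]opC [op q u]opC opK.
have gD v : v \in D -> g v \in used D g.
  by move=> vD; rewrite inE; apply/orP; left; apply/imsetP; exists v.
have thirdD e : e \in active D -> third g e \in used D g.
  by move=> eA; rewrite inE; apply/orP; right; apply/imsetP; exists e.
pose g' v := if v == x then q else g v.
have g'x : g' x = q by rewrite /g' eqxx.
have g'D v : v \in D -> g' v = g v.
  by rewrite /g'; case: eqP => // ->; rewrite (negbTE xD).
have actP e : e \in active (x |: D) ->
    (e \in active D /\ third g' e = third g e) \/
    [/\ e \in Ex, oth e \in D & third g' e = op q (g (oth e))].
  rewrite !inE => /and3P[eT tD bD]; have tb := rooted_top_bot T_rooted eT.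
  move: tD bD; rewrite eT /third /oth /=.
  have [tx|tx] := eqVneq (top e) x => /= tD.
    have [bx|bx] := eqVneq (bot e) x => /= bD; first by rewrite tx bx eqxx in tb.
    by right; rewrite bD tx g'x g'D // eqxx.
  have [bx|bx] := eqVneq (bot e) x => /= bD.
    by right; rewrite tD bx g'x g'D // opC eq_sym (negbTE tx) eqxx.
  by left; rewrite tD bD !g'D.
(* Two edges joining the same ends in opposite directions would contradict depth; in the same
   direction they share [bot]. *)
have Ex_eq e e' : e \in Ex -> e' \in Ex -> oth e = oth e' -> e = e'.
  rewrite !inE /oth => /and3P[eT xe _] /and3P[e'T xe' _].
  have de := rooted_dep T_rooted eT; have de' := rooted_dep T_rooted e'T.
  move: xe xe'; rewrite ![x == _]eq_sym.
  have [tx|tx] := eqVneq (top e) x => /= xe; have [tx'|tx'] := eqVneq (top e') x => /= xe' oth_eq.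
  - exact: (rooted_bot_inj T_rooted).
  - by move: de de'; rewrite (eqP xe') -oth_eq tx; lia.
  - by move: de de'; rewrite (eqP xe) oth_eq tx'; lia.
  - by apply: (rooted_bot_inj T_rooted); rewrite // (eqP xe) (eqP xe').
exists g'; split.
  split.
  - move=> v v'; rewrite !inE => /orP[/eqP ->|vD] /orP[/eqP ->|vD'] //.
    + by rewrite g'x g'D // => h; move: qU; rewrite h gD.
    + by rewrite g'x g'D // => h; move: qU; rewrite -h gD.
    + by rewrite !g'D //; apply: g1.
  - move=> e e' eA eA'; case: (actP e eA) => [[eD ->]|[eE oD ->]];
      case: (actP e' eA') => [[eD' ->]|[eE' oD' ->]].
    + exact: g2.
    + by move=> h; move: (quU _ (lP _ eE')); rewrite -h thirdD.
    + by move=> h; move: (quU _ (lP _ eE)); rewrite h thirdD.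
    + by move=> /(congr1 (op q)); rewrite !opK => /g1 h; apply: Ex_eq => //; apply: h.
  - move=> e v eA; rewrite !inE => vD; case: (actP e eA) => [[eD ->]|[eE oD ->]].
      move: vD => /orP[/eqP ->|vD]; last by rewrite g'D //; apply: g3.
      by rewrite g'x => h; move: qU; rewrite -h thirdD.
    move: vD => /orP[/eqP ->|vD].
      rewrite g'x => /(congr1 (op q)); rewrite opK opxx => h.
      by move: qU; rewrite -h gD.
    by rewrite g'D // => h; move: (quU _ (lP _ eE)); rewrite h gD.
apply: (@leq_trans #|B :|: (q |: [set op q u | u in l])|).
  apply: subset_leq_card; apply/subsetP => y; rewrite inE => /andP[yU yQ].
  move: yU; rewrite inE => /orP[/imsetP[v vD yE]|/imsetP[e eA yE]].
    move: vD; rewrite in_setU1 => /orP[/eqP vx|vD].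
      by rewrite yE vx g'x !inE eqxx orbT.
    by rewrite in_setU in_setI yQ andbT yE g'D // gD.
  case: (actP e eA) => [[eD tE]|[eE oD tE]].
    by rewrite in_setU in_setI yQ andbT yE tE thirdD.
  rewrite yE tE 2!in_setU; apply/orP; right; apply/orP; right; apply/imsetP.
  by exists (g (oth e)) => //; apply: lP.
apply: leq_trans (leq_card_setU _ _) _; rewrite leq_add2l cardsU1 -add1n.
rewrite leq_add ?leq_b1 //; apply: leq_trans (leq_imset_card _ _) _.
by apply: leq_trans (card_size _) sl.
Qed.

(** The used part of [Q] plus [d.+1] for every vertex still to be placed does not increase along
    greedy steps. *)
Lemma greedy_completion D g : partial_embedding D g -> D \subset core ->
  (#|used D g :&: Q| + #|core :\: D| * d.+1) * d.+1 <= N ->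
  exists g', partial_embedding core g'.
Proof.
move: {2}#|core :\: D| (erefl #|core :\: D|) => k.
elim: k D g => [|k IH] D g cD pg Dc BN.
  exists g; suff <- : D = core by [].
  apply/eqP; rewrite eqEsubset Dc -setD_eq0 -cards_eq0 cD eqxx //.
have /card_gt0P[x] : 0 < #|core :\: D| by rewrite cD.
rewrite inE => /andP[xD xc].
have [|g' [pg' B']] := greedy_step pg xD.
  by apply: leq_trans BN; rewrite leq_mul2r leq_addr orbT.
have cD' : #|core :\: (x |: D)| = k.
  move: cD; rewrite (cardsD1 x) inE xD xc /= add1n => -[<-].
  by apply: eq_card => y; rewrite !inE negb_or andbA.
apply: (IH _ g' cD' pg').
  by rewrite subUset sub1set xc.
apply: leq_trans BN; rewrite leq_mul2r; apply/orP; right.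
by rewrite cD' cD mulSn addnA leq_add2r.
Qed.

End GreedyCompletion.

(** * Combining the level embedding with the greedy completion *)

Section Assembly.
Local Open Scope nat_scope.
Variables (W V : finType) (op : W -> W -> W) (T : {set {set V}}) (S : {set {set W}}).
Hypothesis opC : commutative op.
Hypothesis opxx : forall x, op x x = x.
Hypothesis opK : forall x y, op x (op x y) = y.
Hypothesis opS : forall x y, x != y -> [set x; y; op x y] \in S.
Variables (r : V) (top bot mid : {set V} -> V) (dep : V -> nat).
Hypothesis T_rooted : rooted T r top bot mid dep.
Variables (L d : nat) (lev : {set V} -> 'I_L) (idx : {set V} -> 'I_d).
Hypothesis L_gt0 : 0 < L.
Hypothesis degT : forall v, hdegree T v <= d.
Hypothesis idx_inj : forall e e', e \in T -> e' \in T ->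
  top e = top e' -> idx e = idx e' -> e = e'.
Hypothesis lev_parent : forall e e', e \in T -> e' \in T -> bot e' = top e ->
  0 < lev e -> lev e = (lev e').+1 :> nat.
Variables (f : {ffun W -> option ('I_L * 'I_d * bool)}) (N0 N : nat).
Hypothesis class_matching : forall i (tgt : {set V} -> option W),
  (forall e e' p, e \in edge_class T lev idx i -> e' \in edge_class T lev idx i ->
     tgt e = Some p -> tgt e' = Some p -> e = e') ->
  exists M, valid op (edge_class T lev idx i) tgt (label_class f (i, false))
              (label_class f (i, true)) M /\
            #|unassigned (edge_class T lev idx i) M| <= N0.
Hypothesis rich : forall u : {ffun 'I_d -> W}, N < #|candidates op None u f|.
Hypothesis few : (1 + #|[set e in T | lev e == 0 :> nat]| + L.-1 * (d * N0))
  * d.+1 * d.+1 <= N.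

(** The level embedding uses only points labelled [Some _], so the reserve is untouched when the
    greedy phase starts. What remains is the root, the lower ends of level 0 edges, and the lower
    ends of edges that the matchings left out. *)
Lemma embedding_of_labelling : (0 < #|W|)%N -> subhypergraph T S.
Proof.
move=> /card_gt0P[w0 _].
have [G [J0 J1 J2 [J3 J4 J5]]] := level_embedding T_rooted idx_inj lev_parent
  class_matching L_gt0.
pose D := bot @: [set e in T | G e != None].
pose g v := if [pick e in T | bot e == v] is Some e then odflt w0 (G e) else w0.
have gE e a : G e = Some a -> g (bot e) = a.
  move=> Ge; have [eT _ _] := J0 _ _ Ge.
  rewrite /g; case: pickP => [e' /andP[e'T /eqP h]|/(_ e)]; last by rewrite eT eqxx.
  by rewrite (rooted_bot_inj T_rooted e'T eT h) Ge.
have DP v : v \in D -> exists e a, [/\ e \in T, v = bot e & G e = Some a].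
  move=> /imsetP[e]; rewrite inE => /andP[eT Ge] ->; exists e.
  by case: (G e) Ge => // a _; exists a.
have AP e : e \in active T top bot D -> exists e' a a',
   [/\ G e = Some a, G e' = Some a', bot e' = top e & third op top bot g e = op a' a].
  rewrite inE => /and3P[eT /DP[e' [a' [e'T te Ge']]] /DP[e2 [a [e2T be Ge]]]].
  have ee := rooted_bot_inj T_rooted eT e2T be; rewrite -ee in Ge.
  by exists e', a, a'; rewrite /third te (gE _ _ Ge') (gE _ _ Ge).
have pg : partial_embedding op T top bot D g.
  split.
  - move=> v v' /DP[e [a [eT -> Ge]]] /DP[e' [a' [e'T -> Ge']]].
    rewrite (gE _ _ Ge) (gE _ _ Ge') => aa; rewrite aa in Ge.
    by rewrite (J3 _ _ _ Ge Ge').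
  - move=> e1 e2 /AP[e1' [a1 [a1' [G1 G1' b1 ->]]]] /AP[e2' [a2 [a2' [G2 G2' b2 ->]]]].
    exact: (J4 _ _ _ _ _ _ _ _ G1 G1' b1 G2 G2' b2).
  - move=> e v /AP[e1' [a1 [a1' [G1 G1' b1 ->]]]] /DP[e' [a' [e'T -> Ge']]].
    by rewrite (gE _ _ Ge') => h; have := J2 _ _ _ _ G1 G1' b1; rewrite h (J1 _ _ Ge').
pose Q := [set x | f x == None].
have Qr (l : seq W) : size l <= d -> N < #|[set q in Q | all (fun u => op q u \in Q) l]|.
  (* Padding a short list with [w0] only adds conditions on [q]. *)
  move=> sl; apply: leq_trans (rich [ffun i : 'I_d => nth w0 l i]) _.
  apply: subset_leq_card; apply/subsetP => q; rewrite !inE => /forall_inP qP.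
  apply/andP; split; first by apply: qP; rewrite !inE eqxx.
  apply/(all_nthP w0) => i il; rewrite inE; apply: qP; rewrite !inE.
  apply/orP; right; apply/imsetP; exists (Ordinal (leq_trans il sl)) => //.
  by rewrite ffunE.
have Dc : D \subset core T mid.
  apply/subsetP => v /DP[e [a [eT -> _]]]; rewrite inE; apply/forall_inP => e' e'T.
  exact: (rooted_bot_mid T_rooted).
have U0 : used op T top bot D g :&: Q = set0.
  apply/setP => y; rewrite in_set0 !inE; apply/negbTE/negP => /andP[+ /eqP fy].
  case/orP => [/imsetP[v /DP[e [a [_ -> Ge]]] yE]|/imsetP[e /AP[e' [a [a' [Ge Ge' be ->]]]] yE]].
    by move: fy; rewrite yE (gE _ _ Ge) (J1 _ _ Ge).
  by move: fy; rewrite yE (J2 _ _ _ _ Ge Ge' be).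
have cF : #|core T mid :\: D| <= 1 + #|[set e in T | lev e == 0 :> nat]| + L.-1 * (d * N0).
  apply: (@leq_trans #|(r |: bot @: [set e in T | lev e == 0 :> nat]) :|:
     bot @: [set e in T | (0 < lev e <= L.-1) && (G e == None)]|).
    apply: subset_leq_card; apply/subsetP => v; rewrite in_setD => /andP[vD vc].
    case: (rooted_cover T_rooted v) => [->|[e eT [vb|vm]]]; first by rewrite !inE eqxx.
      have Ge : G e = None.
        case Ge: (G e) => [a|//]; case/negP: vD; apply/imsetP; exists e => //.
        by rewrite inE eT Ge.
      rewrite vb !in_setU; case: (posnP (lev e)) => l0.
        apply/orP; left; apply/orP; right; apply/imsetP; exists e => //.
        by rewrite inE eT l0.
      apply/orP; right; apply/imsetP; exists e => //.
      by rewrite inE eT l0 Ge eqxx andbT /=; have := ltn_ord (lev e); lia.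
    by move: vc; rewrite inE => /forall_inP /(_ e eT); rewrite vm eqxx.
  apply: leq_trans (leq_card_setU _ _) _; apply: leq_add; last first.
    by apply: leq_trans (leq_imset_card _ _) J5.
  rewrite cardsU1; apply: leq_add; first exact: leq_b1.
  exact: leq_imset_card.
have [|g' pg'] := greedy_completion opC opxx opK T_rooted degT Qr pg Dc.
  rewrite U0 cards0 add0n; apply: leq_trans few.
  by rewrite !leq_mul2r cF !orbT.
exact: (embedding_of_partial T_rooted opS pg').
Qed.

End Assembly.

(** * Choice of the parameters *)

Section TreeIndexing.
Local Open Scope nat_scope.
Variables (V : finType) (T : {set {set V}}).
Variables (r : V) (top bot mid : {set V} -> V) (dep : V -> nat).
Hypothesis T_rooted : rooted T r top bot mid dep.

(** The index is the position of [e] among the edges at its top. *)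
Lemma child_index d : 0 < d -> (forall v, hdegree T v <= d) ->
  exists idx : {set V} -> 'I_d, forall e e', e \in T -> e' \in T ->
    top e = top e' -> idx e = idx e' -> e = e'.
Proof.
move=> d0 degT.
pose star v := enum [set e in T | v \in e].
exists (fun e => insubd (Ordinal d0) (index e (star (top e)))).
have star_in e : e \in T -> e \in star (top e).
  move=> eT; rewrite mem_enum inE eT /=.
  by rewrite {2}(rooted_edge T_rooted eT) !inE eqxx.
have lt e : e \in T -> index e (star (top e)) < d.
  move=> eT; apply: leq_trans (degT (top e)).
  by rewrite /hdegree cardE index_mem star_in.
move=> e e' eT e'T tt /(congr1 val); rewrite !val_insubd !lt // => ii.
have {ii} := congr1 (nth e (star (top e))) ii.
by rewrite {3}tt !nth_index ?star_in // -?tt ?star_in // tt star_in.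
Qed.

(** By pigeonhole some residue [rho] of the depth modulo [L] is sparse; adding [L - rho] moves it to
    level 0. *)
Lemma level_shift L : 0 < L ->
  exists lev : {set V} -> 'I_L,
    (forall e e', e \in T -> e' \in T -> bot e' = top e ->
       0 < lev e -> lev e = (lev e').+1 :> nat) /\
    L * #|[set e in T | lev e == 0 :> nat]| <= #|T|.
Proof.
move=> L0.
pose res (e : {set V}) := Ordinal (ltn_pmod (dep (bot e)) L0).
have [rho rhoP] : exists rho : 'I_L, L * #|[set e in T | res e == rho]| <= #|T|.
  apply/existsP; apply: contraT; rewrite negb_exists => /forallP H.
  have : \sum_(rho < L) #|T|.+1 <= \sum_(rho < L) L * #|[set e in T | res e == rho]|.
    by apply: leq_sum => rho _; rewrite ltnNge.
  rewrite -big_distrr sum_nat_const card_ord /= leq_pmul2l //.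
  rewrite -[in X in X <= _]sum1_card (partition_big res xpredT) //=.
  suff -> : \sum_(j < L) \sum_(i in T | res i == j) 1 =
     \sum_(i < L) #|[set e in T | res e == i]| by rewrite ltnn.
  by apply: eq_bigr => j _; rewrite -sum1_card; apply: eq_bigl => e; rewrite inE.
exists (fun e => Ordinal (ltn_pmod (dep (bot e) + (L - rho)) L0)); split.
  move=> e e' eT e'T bt /=; rewrite (rooted_dep T_rooted eT) -bt addSn -[(_ + _).+1]addn1 -modnDml.
  set y := (dep (bot e') + (L - rho)) %% L => h.
  have yL : y < L by rewrite ltn_pmod.
  have [|yL'] := ltnP (y + 1) L; first by move=> h'; rewrite (modn_small h') addn1.
  by move: h; rewrite (_ : y + 1 = L) ?modnn //; lia.
apply: leq_trans rhoP; rewrite leq_pmul2l //; apply: subset_leq_card.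
apply/subsetP => e; rewrite !inE => /andP[-> /= /eqP]; rewrite -modnDml => h.
apply/eqP; apply: val_inj => /=; move: h; set y := dep (bot e) %% L.
have yL : y < L by rewrite ltn_pmod.
have rL := ltn_ord rho.
have [lt|ge] := ltnP y rho; first by rewrite modn_small; lia.
rewrite (_ : y + (L - rho) = (y - rho) + L); last by lia.
by rewrite modnDr modn_small; lia.
Qed.

(** Lower ends and private vertices are all distinct. *)
Lemma card_edges_le : (#|T| * 2 <= #|V|)%N.
Proof.
have -> : #|T| * 2 = #|bot @: T| + #|mid @: T|.
  rewrite muln2 -addnn; congr (_ + _); rewrite card_in_imset // => e e'.
    exact: (rooted_bot_inj T_rooted).
  exact: (rooted_mid_inj T_rooted).
rewrite -cardsUI [X in _ + X](_ : _ = 0) ?addn0 ?max_card //.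
apply/eqP; rewrite cards_eq0; apply/eqP/setP => v; rewrite in_set0 inE.
apply/negbTE/negP => /andP[/imsetP[e eT ->] /imsetP[e' e'T]].
by move/eqP; rewrite (negbTE (rooted_bot_mid T_rooted eT e'T)).
Qed.

Lemma sum_edge_class L d (lev : {set V} -> 'I_L) (idx : {set V} -> 'I_d) :
  \sum_i #|edge_class T lev idx i| = #|T|.
Proof.
rewrite -sum1_card (partition_big (fun e => (lev e, idx e)) xpredT) //=.
by apply: eq_bigr => i _; rewrite -sum1_card; apply: eq_bigl => e; rewrite inE.
Qed.

End TreeIndexing.

Lemma subdivision_tree_edge (V : finType) (T : {set {set V}}) :
  subdivision_tree T -> (1 < #|V|)%N -> exists e, e \in T.
Proof.
move=> [[_ _ up] _] /card_gt1P[x [y [_ _ xy]]].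
have [[|[e v] p] [[wk lst _ _] _]] := up x y.
  by move: xy; rewrite -lst eqxx.
by move: wk => /= /andP[eT _]; exists e.
Qed.

(** * Label weights and constants *)

Section Weights.
Variables (R : realFieldType) (A : finType) (v : A * bool -> R).

Definition label_weight (x : option (A * bool)) : R :=
  if x is Some a then v a else 1 - \sum_a v a.

Lemma sum_label_weight : \sum_x label_weight x = 1.
Proof.
rewrite (bigD1 None) //= (reindex_omap Some id) /=; last by case.
rewrite [X in _ + X](eq_bigl xpredT) => [|a]; last by rewrite eqxx.
by rewrite subrK.
Qed.

End Weights.

Lemma subdivision_tree_embedding (R : realType) (d : nat) (mu : R) :
  (0 < d)%N -> 0 < mu -> mu <= 1 ->
  exists n0 : nat, forall (V W : finType) (T : {set {set V}}) (S : {set {set W}}),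
    (n0 < #|V|)%N -> subdivision_tree T -> (forall v : V, (hdegree T v <= d)%N) ->
    steiner_triple_system S -> (1 + mu) * #|V|%:R <= #|W|%:R ->
    subhypergraph T S.
Proof.
move=> d0 mu0 mu1.
have th0 : 0 < mu / 4 by lra.
have th1 : mu / 4 <= 1 by lra.
have [h h0 labP] := labelling_exists d th0 th1.
(* The greedy phase costs [d.+1 * d.+1] per remaining vertex out of [#|W| %/ h] candidates, so [H]
   times the number of remaining vertices must not exceed [#|W|]. The choices of [L] and [eta] keep
   the level 0 edges and the unmatched edges to a quarter each, and the root fits in a third
   quarter. *)
pose H := (d.+1 * d.+1 * h)%N.
have H0 : (0 < H)%N by rewrite !muln_gt0 h0.
pose L := (4 * H)%N.
have L0 : (0 < L)%N by rewrite muln_gt0.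
have HR : 1 <= H%:R :> R by rewrite ler1n.
have LR : L%:R = 4 * H%:R :> R by rewrite natrM.
have HE : H = (d.+1 * d.+1 * h)%N by [].
clearbody L; clearbody H.
have dR : 1 <= d%:R :> R by rewrite ler1n.
have LdH1 : 1 <= L%:R * d%:R * H%:R :> R.
  by rewrite -!natrM ler1n !muln_gt0 L0 d0 H0.
have Ld1 : 1 <= L%:R * d%:R :> R by rewrite -!natrM ler1n !muln_gt0 L0 d0.
pose eta : R := (4 * (L%:R * d%:R * H%:R))^-1.
have eta0 : 0 < eta by rewrite invr_gt0; lra.
have etaE : L%:R * d%:R * H%:R * eta = 4^-1.
  by rewrite /eta; field; rewrite gt_eqF //; lra.
have eta1 : eta <= 1 by nra.
(* There are [2 * L * d] label sets, so their surpluses add up to [mu / 4]. *)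
pose delta : R := mu / (8 * (L%:R * d%:R)).
have delta0 : 0 < delta by rewrite divr_gt0 //; lra.
have deltaE : L%:R * d%:R * delta = mu / 8.
  by rewrite /delta; field; rewrite gt_eqF //; lra.
have delta1 : delta <= 1 by nra.
pose eps := delta ^+ 2 * eta / 16.
have eps0 : 0 < eps by rewrite divr_gt0 // mulr_gt0 // exprn_gt0.
have eps1 : 16 * eps <= delta ^+ 2 * eta by rewrite /eps; lra.
have eps2 : 2 * eps <= delta.
  have : delta ^+ 2 * eta <= delta.
    rewrite -[leRHS]mulr1; apply: ler_pM => //; [exact: exprn_ge0 (ltW _)|exact: ltW|].
    by rewrite -[leRHS]mulr1 expr2 ler_pM2l.
  by rewrite /eps; lra.
pose steps := (Num.truncn (8 / delta)).+1.
have stepsP : 8 <= delta * steps%:R.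
  by rewrite mulrC -ler_pdivrMr // ltW // truncnS_gt.
have [m0 {}labP] := labP #|{: option ('I_L * 'I_d * bool)}| eps eps0.
pose n1 := (Num.truncn (steps%:R / eps)).+1.
pose n2 := (Num.truncn (16 / delta)).+1.
exists (m0 + (L + (n1 + n2)))%N => V W T S nV treeT degT stsS VW.
set m : R := #|W|%:R in VW.
have VWn : (#|V| <= #|W|)%N.
  rewrite -(ler_nat R) -/m; apply: le_trans VW.
  by rewrite mulrDl mul1r lerDl mulr_ge0 // ltW.
have big : (m0 + (L + (n1 + n2)) <= #|W|)%N by apply: leq_trans (ltnW nV) VWn.
have m_m0 : (m0 <= #|W|)%N by apply: leq_trans big; apply: leq_addr.
have m_L : (L <= #|W|)%N.
  by apply: leq_trans big; rewrite -[X in (X <= _)%N]add0n leq_add // leq_addr.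
have m_n1 : n1%:R <= m.
  rewrite ler_nat; apply: leq_trans big; rewrite addnA -[X in (X <= _)%N]add0n.
  by rewrite leq_add // leq_addr.
have m_n2 : n2%:R <= m by rewrite ler_nat; apply: leq_trans big; rewrite !addnA leq_addl.
have steps_m : steps%:R <= eps * m.
  by rewrite mulrC -ler_pdivrMr //; apply: le_trans m_n1; rewrite ltW // truncnS_gt.
have delta_m : 16 <= delta * m.
  by rewrite mulrC -ler_pdivrMr //; apply: le_trans m_n2; rewrite ltW // truncnS_gt.
have m_gt0 : 0 < m by nra.
have V1 : (1 < #|V|)%N.
  apply: leq_ltn_trans nV; apply: leq_trans (leq_addl _ _).
  by apply: leq_trans (leq_addr _ _); apply: leq_trans L0 _.
have [e0 e0T] := subdivision_tree_edge treeT V1.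
have [r [top [bot [mid [dep T_rooted]]]]] := subdivision_tree_rooted treeT e0T.
have [op [opC opxx opK opS]] := steiner_operation stsS.
have [idx idx_inj] := child_index T_rooted d0 degT.
have [lev [lev_parent lev0]] := level_shift T_rooted L0.
have TV : 2 * #|T|%:R <= #|V|%:R :> R.
  by rewrite -natrM ler_nat mulnC (card_edges_le T_rooted).
pose v (a : ('I_L * 'I_d) * bool) : R := #|edge_class T lev idx a.1|%:R / m + delta.
have v0 a : 0 <= v a by apply: addr_ge0; [rewrite divr_ge0 // ltW|exact: ltW].
have sum_v : \sum_a v a = 2 * #|T|%:R / m + mu / 4.
  rewrite -(pair_bigA _ (fun i b => v (i, b))) /=.
  under eq_bigr => i _ do rewrite big_bool /v /=.
  have cst : \sum_(i : 'I_L * 'I_d) delta = mu / 8.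
    by rewrite sumr_const card_prod !card_ord -[LHS]mulr_natl natrM.
  rewrite !big_split /= cst -!mulr_suml -!natr_sum (sum_edge_class T lev idx).
  by field; rewrite gt_eqF.
have w_None : mu / 4 <= label_weight v None.
  (* Since [2 * #|T| <= #|V|] and [(1 + mu) * (1 - mu / 2) >= 1] for [mu <= 1], the tree takes
     weight at most [1 - mu / 2] and the surpluses [mu / 4], which leaves [mu / 4] for the
     reserve. *)
  rewrite /= sum_v; have : 2 * #|T|%:R / m <= 1 - mu / 2; last by lra.
  rewrite ler_pdivrMr //; have V0 : 0 <= #|V|%:R :> R by exact: ler0n.
  have c1 : 0 <= 1 - mu / 2 by lra.
  have := ler_wpM2l c1 VW.
  have : 0 <= mu * (1 - mu) * #|V|%:R by rewrite !mulr_ge0 //; lra.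
  by lra.
have w_ge0 x : 0 <= label_weight v x.
  by case: x => [a|] //=; apply: le_trans w_None; lra.
have [f [fdisc fcand]] := labP W _ op (label_weight v) None opC opK w_ge0
   (sum_label_weight v) w_None (leqnn _) m_m0.
pose N0 := Num.truncn (eta * m).
apply: (@embedding_of_labelling W V op T S opC opxx opK opS r top bot mid dep T_rooted
  L d lev idx L0 degT idx_inj lev_parent f N0 (#|W| %/ h)).
- move=> i tgt tgt_inj.
  have [M vM cM] := near_matching_of_discrepancy opC opK tgt_inj delta0 eta0 eps1 eps2
    stepsP steps_m delta_m (fdisc (Some (i, false))) (fdisc (Some (i, true))).
  exists M; split=> //; rewrite /N0 truncn_ge_nat //.
  by rewrite mulr_ge0 // ltW.
- by move=> u; rewrite ltn_divLR // mulnC fcand.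
- rewrite leq_divRL // -mulnA -mulnA [(_ * (_ * _))%N](_ : _ = (1 +
    #|[set e in T | lev e == 0%N :> nat]| + L.-1 * (d * N0)) * H)%N; last first.
    by rewrite HE; ring.
  rewrite -(ler_nat R) -/m natrM !natrD !natrM.
  have N0P : N0%:R <= eta * m by rewrite truncn_le // mulr_ge0 // ltW.
  have l0P : L%:R * #|[set e in T | lev e == 0%N :> nat]|%:R <= m.
    rewrite -natrM ler_nat; apply: leq_trans lev0 _; apply: leq_trans VWn.
    by apply: leq_trans (card_edges_le T_rooted); rewrite leq_pmulr.
  have L1P : L.-1%:R <= L%:R :> R by rewrite ler_nat leq_pred.
  have a1 : H%:R <= m / 4.
    by have : L%:R <= m; [rewrite ler_nat|rewrite LR; lra].
  have a2 : #|[set e in T | lev e == 0%N :> nat]|%:R * H%:R <= m / 4.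
    by move: l0P; rewrite LR; lra.
  have a3 : L.-1%:R * (d%:R * N0%:R) * H%:R <= m / 4.
    apply: (@le_trans _ _ (L%:R * (d%:R * (eta * m)) * H%:R)).
      by rewrite ler_wpM2r // ler_pM ?mulr_ge0 // ler_wpM2l.
    have -> : L%:R * (d%:R * (eta * m)) * H%:R = (L%:R * d%:R * H%:R * eta) * m by ring.
    by rewrite etaE; lra.
  by rewrite !mulrDl mul1r; lra.
- by rewrite -(ltr_nat R).
Qed.

Theorem mainTheorem1 (R : realType) (d : nat) (hd : (0 < d)%N) :
  exists2 mu0 : R, 0 < mu0 &
  forall mu : R, 0 < mu -> mu <= mu0 ->
  exists n0 : nat,
  forall n : nat, odd n -> (n0 < n)%N ->
  forall (V : finType) (T : {set {set V}}),
    #|V| = n -> subdivision_tree T -> (forall v : V, (hdegree T v <= d)%N) ->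
  forall (m : nat) (W : finType) (S : {set {set W}}),
    #|W| = m -> steiner_triple_system S -> (1 + mu) * n%:R <= m%:R ->
  subhypergraph T S.
Proof.
exists 1 => // mu mu0 mu1.
have [n0 n0P] := subdivision_tree_embedding hd mu0 mu1.
exists n0 => n _ n0n V T cV treeT degT m W S cW stsS nm.
by apply: n0P; rewrite // ?cV ?cW.
Qed.
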